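(* Let $\mathbf{L}\in Q(\mathbb{B}^n)$. An analytic function $F:\mathbb{B}^n\to\mathbb{C}$ has bounded $\mathbf{L}$-index in joint variables if and only if there exist $c\in(0,\infty)$ and $N\in\mathbb{N}$ such that for each $z\in\mathbb{B}^n$ $$\sum_{\|K\|=0}^{N}\frac{|F^{(K)}(z)|}{K!\,\mathbf{L}^K(z)}\ \ge\ c\sum_{\|K\|=N+1}^{\infty}\frac{|F^{(K)}(z)|}{K!\,\mathbf{L}^K(z)},$$ where the left sum is over all $K\in\mathbb{Z}^n_+$ with $\|K\|\le N$ and the right sum over all $K\in\mathbb{Z}^n_+$ with $\|K\|\ge N+1$.
   Context: $\mathbb{R}_+=[0,\infty)$, $\mathbb{Z}_+=\{0,1,2,\dots\}$. $|\cdot|$ is the Euclidean norm on $\mathbb{C}^n$ (and on $\mathbb{R}^n$); $\mathbb{B}^n=\{z\in\mathbb{C}^n:|z|<1\}$. For $K\in\mathbb{Z}^n_+$: $\|K\|=k_1+\dots+k_n$, $K!=k_1!\cdots k_n!$, $A^K=a_1^{k_1}\cdots a_n^{k_n}$, and $F^{(K)}=\partial^{\|K\|}F/\partial z_1^{k_1}\cdots\partial z_n^{k_n}$. Quotients $A/B$ of vectors are componentwise. $\mathbb{D}^n[z^0,R]=\{z:|z_j-z^0_j|\le r_j,\ j=1,\dots,n\}$ for $R=(r_1,\dots,r_n)\in\mathbb{R}^n_+$. Series of nonnegative terms take values in $[0,\infty]$. Fix a constant $\beta>\sqrt n$. Throughout, $\mathbf{L}(z)=(l_1(z),\dots,l_n(z))$,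 where each $l_j:\mathbb{B}^n\to\mathbb{R}_+$ is continuous and $l_j(z)>\beta/(1-|z|)$ for all $z\in\mathbb{B}^n$. (Then $\mathbb{D}^n[z^0,R/\mathbf{L}(z^0)]\subset\mathbb{B}^n$ whenever $z^0\in\mathbb{B}^n$, $|R|\le\beta$.) $Q(\mathbb{B}^n)$ is the class of such $\mathbf{L}$ satisfying, for all $R\in\mathbb{R}^n_+$ with $|R|\le\beta$ and all $j$, $0<\lambda_{1,j}(R)\le\lambda_{2,j}(R)<\infty$, where $\lambda_{1,j}(R)$ and $\lambda_{2,j}(R)$ are respectively the infimum and the supremum of $l_j(z)/l_j(z^0)$ over all $z^0\in\mathbb{B}^n$ and $z\in\mathbb{D}^n[z^0,R/\mathbf{L}(z^0)]$. An analytic $F:\mathbb{B}^n\to\mathbb{C}$ is of bounded $\mathbf{L}$-index in joint variables if there is $m\in\mathbb{Z}_+$ such that for all $z\in\mathbb{B}^n$ and $J\in\mathbb{Z}^n_+$: $\frac{|F^{(J)}(z)|}{J!\mathbf{L}^J(z)}\le\max\{\frac{|F^{(K)}(z)|}{K!\mathbf{L}^K(z)}:K\in\mathbb{Z}^n_+,\|K\|\le m\}$. *)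

(* Defs.v *)
From HB Require Import structures.
From mathcomp Require Import all_boot all_order all_algebra.
From mathcomp Require Import all_classical all_reals all_analysis.
From mathcomp Require Import complex.
From mathcomp Require summability.

Set Implicit Arguments.
Unset Strict Implicit.
Unset Printing Implicit Defensive.

Import Order.TTheory GRing.Theory Num.Theory numFieldNormedType.Exports.

Local Open Scope classical_set_scope.
Local Open Scope ring_scope.

(* [R[i]] packed as a [numClosedFieldType]: the bare type [R[i]] is not seen as
   a normed module, whereas the sort of an abstract numeric field gets the
   topology of its norm from [numFieldNormedType.Exports].  Hence the complex
   derivative is [derive1] over [Cplx R], and ['rV[Cplx R]_n] has the product
   topology, i.e. the usual topology of $\mathbb{C}^n$. *)
Definition Cplx (R : realType) : numClosedFieldType := R[i].

(* The norm [`|w|] of [w : Cplx R] lives in [Cplx R]; this is the modulus with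
   values in [R]. *)
Definition cabs (R : realType) (w : Cplx R) : R := Normc.normc w.

Definition enorm (R : realType) (n : nat) (v : 'rV[R]_n) : R :=
  Num.sqrt (\sum_(j < n) v 0 j ^+ 2).

Definition cenorm (R : realType) (n : nat) (z : 'rV[Cplx R]_n) : R :=
  enorm (map_mx (@cabs R) z).

Definition unit_ball (R : realType) (n : nat) : set 'rV[Cplx R]_n :=
  [set z | cenorm z < 1].
Arguments unit_ball : clear implicits.

Definition polydisc (R : realType) (n : nat)
    (z0 : 'rV[Cplx R]_n) (r : 'rV[R]_n) : set 'rV[Cplx R]_n :=
  [set z | forall j, cabs (z 0 j - z0 0 j) <= r 0 j].

Notation multiindex n := {ffun 'I_n -> nat}.

Definition mdeg (n : nat) (K : multiindex n) : nat := \sum_(j < n) K j.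

Definition mfact (n : nat) (K : multiindex n) : nat := \prod_(j < n) (K j)`!.

Definition mpow (A : comNzRingType) (n : nat) (a : 'rV[A]_n)
    (K : multiindex n) : A :=
  \prod_(j < n) a 0 j ^+ K j.

(* Multi-indices of degree at most [m] have entries at most [m]; this embeds
   the finite type of those bounded by [m] into all multi-indices. *)
Definition mwiden (n m : nat) (K : {ffun 'I_n -> 'I_m.+1}) : multiindex n :=
  [ffun j => nat_of_ord (K j)].

Definition partial (R : realType) (n : nat) (j : 'I_n)
    (F : 'rV[Cplx R]_n -> Cplx R) (z : 'rV[Cplx R]_n) : Cplx R :=
  derive1 (fun t : Cplx R => F (z + t *: delta_mx 0 j)) 0.

(* The last variable is differentiated first; on analytic functions the order
   is immaterial.  Functions are total, but at a point of the open ball a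
   derivative only depends on the values of [F] in the ball. *)
Definition mderiv (R : realType) (n : nat) (K : multiindex n)
    (F : 'rV[Cplx R]_n -> Cplx R) : 'rV[Cplx R]_n -> Cplx R :=
  foldr (fun j G => iter (K j) (partial j) G) F (enum 'I_n).

(* Analytic on the ball: near each of its points, [F] is the sum of a power
   series in [n] variables.  Multiple series are summed along the filter of
   finite subsets of the index set, that is, unconditionally (which, for
   complex terms, amounts to absolute convergence). *)
Definition analytic_on_ball (R : realType) (n : nat)
    (F : 'rV[Cplx R]_n -> Cplx R) : Prop :=
  forall z0 : 'rV[Cplx R]_n, unit_ball R n z0 ->
  exists (a : multiindex n -> Cplx R) (r : R), 0 < r /\
    forall z : 'rV[Cplx R]_n, (forall j, cabs (z 0 j - z0 0 j) < r) ->
      summability.partial_sum (fun K => a K * mpow (z - z0) K)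
        @ summability.totally --> F z.

Definition scaled_radius (R : realType) (n : nat)
    (L : 'rV[Cplx R]_n -> 'rV[R]_n) (z0 : 'rV[Cplx R]_n) (r : 'rV[R]_n) :
    'rV[R]_n :=
  \row_j (r 0 j / L z0 0 j).

Definition ratios (R : realType) (n : nat) (L : 'rV[Cplx R]_n -> 'rV[R]_n)
    (j : 'I_n) (r : 'rV[R]_n) : set (\bar R) :=
  [set x | exists z0 z, [/\ unit_ball R n z0,
     polydisc z0 (scaled_radius L z0 r) z &
     x = (L z 0 j / L z0 0 j)%:E]].

Definition lambda1 (R : realType) (n : nat) (L : 'rV[Cplx R]_n -> 'rV[R]_n)
    (j : 'I_n) (r : 'rV[R]_n) : \bar R := ereal_inf (ratios L j r).

Definition lambda2 (R : realType) (n : nat) (L : 'rV[Cplx R]_n -> 'rV[R]_n)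
    (j : 'I_n) (r : 'rV[R]_n) : \bar R := ereal_sup (ratios L j r).

(* The standing assumptions on [L]. *)
Definition admissible (R : realType) (n : nat) (beta : R)
    (L : 'rV[Cplx R]_n -> 'rV[R]_n) : Prop :=
  forall j : 'I_n,
    {within unit_ball R n, continuous (fun z => L z 0 j)} /\
    forall z, unit_ball R n z -> beta / (1 - cenorm z) < L z 0 j.

Definition classQ (R : realType) (n : nat) (beta : R)
    (L : 'rV[Cplx R]_n -> 'rV[R]_n) : Prop :=
  admissible beta L /\
  forall r : 'rV[R]_n, (forall j, 0 <= r 0 j) -> enorm r <= beta ->
  forall j : 'I_n,
    [/\ (0 < lambda1 L j r)%E, (lambda1 L j r <= lambda2 L j r)%E &
        (lambda2 L j r < +oo)%E].

Definition index_term (R : realType) (n : nat)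
    (L : 'rV[Cplx R]_n -> 'rV[R]_n) (F : 'rV[Cplx R]_n -> Cplx R)
    (z : 'rV[Cplx R]_n) (K : multiindex n) : R :=
  cabs (mderiv K F z) / ((mfact K)%:R * mpow (L z) K).

(* The default value 0 of the maximum is harmless: the terms are nonnegative
   and [K = 0] always belongs to the range. *)
Definition bounded_index (R : realType) (n : nat)
    (L : 'rV[Cplx R]_n -> 'rV[R]_n) (F : 'rV[Cplx R]_n -> Cplx R) : Prop :=
  exists m : nat, forall z, unit_ball R n z -> forall J : multiindex n,
    index_term L F z J <=
      \big[Num.max/0]_(K : {ffun 'I_n -> 'I_m.+1} | (mdeg (mwiden K) <= m)%N)
        index_term L F z (mwiden K).

(* Main.v *)
Require Import Defs.
From HB Require Import structures.
From mathcomp Require Import all_boot all_order all_algebra.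
From mathcomp Require Import all_classical all_reals all_analysis.
From mathcomp Require Import complex finmap cyclic separable cyclotomic.
From mathcomp Require summability.
From mathcomp Require Import ring lra.

Set Implicit Arguments.
Unset Strict Implicit.
Unset Printing Implicit Defensive.

Import Order.TTheory GRing.Theory Num.Theory numFieldNormedType.Exports.
Local Open Scope classical_set_scope.
Local Open Scope fset_scope.
Local Open Scope ring_scope.

(** Write [T z K] for [|F^(K)(z)| / (K! L(z)^K)]. Bounded index says that at each
    point every [T z J] is at most the largest [T z K] with [|K| <= m]; the
    inequality between sums says, up to a constant, the same for some [N]. Each
    of them implies that [F] is controlled: for some [N] and [c], a bound [S] on
    the [T z K] with [|K| <= N] entails the bound [c S] on all [T z J]. The
    missing ingredient in both directions is decay: a controlled [F] satisfies
    [T z J <= D S (1 + s) ^ (- |J|)] with [s > 0] and [D] that depend neither on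
    [z] nor on [J] ([controlled_decay]). Summed over [J], the decay bounds the
    tail by a multiple of the low-order sum ([bounded_index_tail]); for large
    [|J|], it makes up for the constant and yields bounded index
    ([tail_bounded_index]).

    The decay is proved on the polydisc about [z] with radii [1 / L(z)]. It lies
    in the ball since [beta > sqrt n], and there the entries of [L] stay within
    a factor [lam] of those of [L(z)], by the class Q property for the radius
    vector [(1, ..., 1)]. Control makes the Taylor series at each point [w] of
    the polydisc converge with radii [1 / (lam L(z))]; it represents [F] there by
    the identity theorem ([taylor_polydisc]). Re-expanding it at nearby points
    shows that the low-order coefficients grow by at most a fixed factor in
    each step of fixed relative length, and boundedly many steps lead from [z]
    to any point of the polydisc ([low_le_step], [low_le_chain]). Control then
    bounds all derivatives of [F] on the whole polydisc, uniformly enough for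
    the Taylor series at [z] to converge beyond it: the Cauchy estimates for
    all the [F^(K) / K!], combined by the binomial theorem, give a radius larger
    by a fixed factor [1 + s] ([wcoef_decay]).

    The function theory needed comes from power series alone. Absolutely
    convergent series may be re-expanded at another point ([recenter]), hence
    differentiated termwise ([powser_partial]), and Taylor coefficients satisfy
    the Cauchy estimate, obtained by averaging over roots of unity in place of
    integrating over a torus ([cauchy_estimate]). *)

(** * The modulus of complex numbers *)

Section Modulus.
Variable R : realType.
Implicit Types v w : Cplx R.

Definition ofreal (x : R) : Cplx R := (x%:C)%C.

Lemma normE w : `|w| = ofreal (cabs w).
Proof. by case: w. Qed.

Lemma cabsM v w : cabs (v * w) = cabs v * cabs w.
Proof. exact: Normc.normcM. Qed.

Lemma cabs0 : cabs (0 : Cplx R) = 0.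
Proof. exact: Normc.normc0. Qed.

Lemma cabs1 : cabs (1 : Cplx R) = 1.
Proof. exact: Normc.normc1. Qed.

Lemma cabs_ge0 w : 0 <= cabs w.
Proof. by case: w => a b; exact: sqrtr_ge0. Qed.

Lemma cabs_eq0 w : (cabs w == 0) = (w == 0).
Proof.
apply/eqP/eqP => [|->]; last exact: cabs0.
exact: Normc.eq0_normc.
Qed.

Lemma cabsD v w : cabs (v + w) <= cabs v + cabs w.
Proof. exact: le_normcD. Qed.

Lemma cabsN w : cabs (- w) = cabs w.
Proof. exact: normcN. Qed.

Lemma cabsB v w : cabs (v - w) <= cabs v + cabs w.
Proof. by rewrite -(cabsN w); exact: cabsD. Qed.

Lemma cabsC v w : cabs (v - w) = cabs (w - v).
Proof. by rewrite -cabsN opprB. Qed.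

Lemma cabsV w : cabs w^-1 = (cabs w)^-1.
Proof. exact: Normc.normcV. Qed.

Lemma cabs_sum (I : Type) (s : seq I) (P : pred I) (f : I -> Cplx R) :
  cabs (\sum_(i <- s | P i) f i) <= \sum_(i <- s | P i) cabs (f i).
Proof.
elim/big_rec2: _ => [|i x y _ h]; first by rewrite cabs0.
by rewrite (le_trans (cabsD _ _)) ?lerD2l.
Qed.

Lemma cabs_prod (I : Type) (s : seq I) (P : pred I) (f : I -> Cplx R) :
  cabs (\prod_(i <- s | P i) f i) = \prod_(i <- s | P i) cabs (f i).
Proof. by elim/big_rec2: _ => [|i x y _ <-]; rewrite ?cabs1 ?cabsM. Qed.

Lemma cabsX w k : cabs (w ^+ k) = cabs w ^+ k.
Proof. by elim: k => [|k IH]; rewrite ?expr0 ?cabs1 // !exprS cabsM IH. Qed.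

Lemma cabs_ofreal (x : R) : cabs (ofreal x) = `|x|.
Proof. by rewrite /cabs/= expr0n addr0 sqrtr_sqr. Qed.

Lemma ofreal_nat k : ofreal k%:R = k%:R.
Proof. exact: (rmorph_nat (real_complex R)). Qed.

Lemma cabs_nat k : cabs (k%:R : Cplx R) = k%:R.
Proof. by rewrite -ofreal_nat cabs_ofreal ger0_norm. Qed.

End Modulus.

(** * Unordered sums of complex families *)

#[local] Existing Instance summability.totally_filter.

Section UnorderedSums.
Variable R : realType.
Local Notation C := (Cplx R).

(** Convergence along the filter of finite sets, spelled out with the real
    modulus. *)
Definition has_sum (I : choiceType) (f : I -> C) (s : C) : Prop :=
  forall e : R, 0 < e -> exists A : {fset I}, forall B : {fset I},
    A `<=` B -> cabs (\sum_(i <- B) f i - s) < e.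

(** For nonnegative [f], a bound on the possibly infinite sum. *)
Definition sums_le (I : choiceType) (f : I -> R) (b : R) : Prop :=
  forall A : {fset I}, \sum_(i <- A) f i <= b.

Lemma partial_sumE (I : choiceType) (f : I -> C) (A : {fset I}) :
  summability.partial_sum f A = \sum_(i <- A) f i.
Proof. by rewrite big_seq_fsetE. Qed.

Lemma has_sum_of_cvg (I : choiceType) (f : I -> C) (s : C) :
  summability.partial_sum f @ summability.totally --> s -> has_sum f s.
Proof.
move=> fs e e0.
have e0' : 0 < ofreal e by rewrite /ofreal ltcR.
have /cvgrPdist_lt /(_ _ e0') [A _ hA] := fs.
exists A => B AB; have := hA _ AB.
by rewrite partial_sumE normE /ofreal ltcR cabsC.
Qed.

Lemma has_sum_ext (I : choiceType) (f g : I -> C) s :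
  f =1 g -> has_sum f s -> has_sum g s.
Proof.
move=> fg fs e /fs [A hA]; exists A => B /hA.
by under eq_bigr do rewrite fg.
Qed.

Lemma has_sum_unique (I : choiceType) (f : I -> C) s t :
  has_sum f s -> has_sum f t -> s = t.
Proof.
move=> fs ft; apply/eqP; rewrite -subr_eq0 -cabs_eq0 eq_le cabs_ge0 andbT.
apply/ler_addgt0Pr => e e0; rewrite add0r.
have e2 : 0 < e / 2 by rewrite divr_gt0.
have [A hA] := fs _ e2; have [B hB] := ft _ e2.
have h1 := hA _ (fsubsetUl A B); have h2 := hB _ (fsubsetUr A B).
rewrite [s - t](_ : _ = (\sum_(i <- A `|` B) f i - t)
   - (\sum_(i <- A `|` B) f i - s)); last by ring.
by rewrite (le_trans (cabsB _ _)) // [e]splitr lerD // ltW.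
Qed.

Lemma has_sumD (I : choiceType) (f g : I -> C) s t :
  has_sum f s -> has_sum g t -> has_sum (fun i => f i + g i) (s + t).
Proof.
move=> fs gt e e0; have e2 : 0 < e / 2 by rewrite divr_gt0.
have [A hA] := fs _ e2; have [B hB] := gt _ e2.
exists (A `|` B) => D; rewrite fsubUset => /andP[/hA h1 /hB h2].
by rewrite big_split /= opprD addrACA (le_lt_trans (cabsD _ _)) // [e]splitr ltrD.
Qed.

Lemma has_sumZ (I : choiceType) (f : I -> C) s (c : C) :
  has_sum f s -> has_sum (fun i => c * f i) (c * s).
Proof.
move=> fs e e0; have c1 : 0 < cabs c + 1 by rewrite ltr_wpDl ?cabs_ge0.
have [A hA] := fs _ (divr_gt0 e0 c1).
exists A => B /hA h; rewrite -mulr_sumr -mulrBr cabsM.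
rewrite (@le_lt_trans _ _ ((cabs c + 1) * cabs (\sum_(i <- B) f i - s))) //.
  by rewrite ler_wpM2r ?cabs_ge0 // lerDl.
by rewrite mulrC -ltr_pdivlMr.
Qed.

Lemma has_sumB (I : choiceType) (f g : I -> C) s t :
  has_sum f s -> has_sum g t -> has_sum (fun i => f i - g i) (s - t).
Proof.
move=> fs /(has_sumZ (-1)) gt; have := has_sumD fs gt.
by rewrite mulN1r; apply: has_sum_ext => i; rewrite mulN1r.
Qed.

Lemma big_fset_supp (V : nmodType) (I : choiceType) (A B : {fset I}) (f : I -> V) :
  A `<=` B -> (forall i, i \notin A -> f i = 0) ->
  \sum_(i <- B) f i = \sum_(i <- A) f i.
Proof.
move=> AB f0; rewrite (big_fset_incl _ AB) // => i _; exact: f0.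
Qed.

Lemma has_sum_fin (I : choiceType) (A : {fset I}) (f : I -> C) :
  (forall i, i \notin A -> f i = 0) -> has_sum f (\sum_(i <- A) f i).
Proof.
move=> f0 e e0; exists A => B AB.
by rewrite (big_fset_supp AB f0) subrr cabs0.
Qed.

Lemma has_sum_sum (I : choiceType) (J : Type) (s : seq J)
    (f : J -> I -> C) (t : J -> C) :
  (forall j, has_sum (f j) (t j)) ->
  has_sum (fun i => \sum_(j <- s) f j i) (\sum_(j <- s) t j).
Proof.
move=> ft; elim: s => [|j s IH].
  rewrite big_nil => e e0; exists fset0 => B _.
  by rewrite big1 ?subrr ?cabs0 // => i _; rewrite big_nil.
rewrite big_cons; apply: has_sum_ext (has_sumD (ft j) IH) => i.
by rewrite big_cons.
Qed.

Lemma ler_sum_fset (I : choiceType) (f : I -> R) (A B : {fset I}) :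
  (forall i, 0 <= f i) -> A `<=` B ->
  \sum_(i <- A) f i <= \sum_(i <- B) f i.
Proof.
move=> f0 AB; rewrite (big_fsetID _ [in A] B)/=.
have -> : [fset x in B | x \in A] = A.
  apply/fsetP => x; rewrite !inE /=; apply/andP/idP => [[]//|xA].
  by split => //; apply: (fsubsetP AB).
by rewrite lerDl sumr_ge0.
Qed.

Lemma sums_le_scale (I : choiceType) (f : I -> R) b c :
  0 <= c -> sums_le f b -> sums_le (fun i => c * f i) (c * b).
Proof. by move=> c0 fb A; rewrite -mulr_sumr ler_wpM2l. Qed.

Lemma sums_le_mono (I : choiceType) (f g : I -> R) b :
  (forall i, f i <= g i) -> sums_le g b -> sums_le f b.
Proof. by move=> fg gb A; rewrite (le_trans _ (gb A)) // ler_sum. Qed.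

Lemma sums_le_sup (I : choiceType) (f : I -> R) b :
  (forall i, 0 <= f i) -> sums_le f b ->
  exists2 s : R, sums_le f s &
    forall e, 0 < e -> exists A : {fset I}, s - e < \sum_(i <- A) f i.
Proof.
move=> f0 fb; set E := range (fun A : {fset I} => \sum_(i <- A) f i).
have supE : has_sup E.
  by split; [exists (\sum_(i <- fset0) f i); exists fset0|exists b => _ [A _ <-]].
exists (sup E) => [A|e e0]; first by apply: ub_le_sup; [case: supE|exists A].
have [_ [A _ <-] hA] := sup_adherent e0 supE; by exists A.
Qed.

(** A finite subfamily whose sum is within [e] of the supremum leaves less than
    [e] to any disjoint one. *)
Lemma sums_le_tail (I : choiceType) (f : I -> R) b e :
  (forall i, 0 <= f i) -> sums_le f b -> 0 < e ->
  exists A : {fset I}, forall B, [disjoint A & B]%fset -> \sum_(i <- B) f i < e.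
Proof.
move=> f0 fb e0; have [s sub /(_ _ e0)[A hA]] := sums_le_sup f0 fb.
exists A => B AB; have := sub (A `|` B).
rewrite (big_fsetID _ [in A] (A `|` B))/=.
rewrite (_ : [fset _ in _ | _] = A); last first.
  by apply/fsetP => x; rewrite !inE andbC; case: (x \in A).
rewrite (_ : [fset _ in _ | _] = B); last first.
  apply/fsetP => x; rewrite !inE; case: (boolP (x \in A)) => // xA /=.
    by apply/esym/negbTE; move/fdisjointP: AB; apply.
  by rewrite andbT.
move=> h; rewrite -(ltrD2l (s - e)) subrK.
by apply: lt_le_trans h; rewrite ltrD2r.
Qed.

Lemma has_sum_nonneg (I : choiceType) (f : I -> R) b :
  (forall i, 0 <= f i) -> sums_le f b ->
  exists s : C, has_sum (fun i => ofreal (f i)) s.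
Proof.
move=> f0 fb; have [s sub hs] := sums_le_sup f0 fb.
exists (ofreal s) => e /hs [A hA]; exists A => B AB.
rewrite /ofreal -(rmorph_sum (real_complex R)) -rmorphB cabs_ofreal distrC.
rewrite ger0_norm ?subr_ge0 //.
by rewrite ltrBlDr -ltrBlDl (lt_le_trans hA) // ler_sum_fset.
Qed.

Lemma cabs_Re (w : C) : `|complex.Re w| <= cabs w.
Proof.
case: w => x y; rewrite /cabs /= -sqrtr_sqr ler_wsqrtr // lerDl; exact: sqr_ge0.
Qed.

Lemma cabs_Im (w : C) : `|complex.Im w| <= cabs w.
Proof.
case: w => x y; rewrite /cabs /= -sqrtr_sqr ler_wsqrtr // lerDr; exact: sqr_ge0.
Qed.

(** The real and imaginary parts are differences of bounded nonnegative
    families: [x = (x + c) - c] with [c = |f i|]. *)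
Lemma has_sum_exists (I : choiceType) (f : I -> C) b :
  sums_le (fun i => cabs (f i)) b -> exists s, has_sum f s.
Proof.
move=> fb; have pos (g : I -> R) : (forall i, `|g i| <= cabs (f i)) ->
    exists s, has_sum (fun i => ofreal (g i)) s.
  move=> gf; have g0 i : 0 <= g i + cabs (f i).
    by rewrite -lerBlDr sub0r; have := gf i; rewrite ler_norml => /andP[].
  have [||s hs] := @has_sum_nonneg _ (fun i => g i + cabs (f i)) (2 * b) => //.
    apply: sums_le_mono (sums_le_scale _ fb) => // i.
    by rewrite mulr_natl mulr2n lerD2r (le_trans (ler_norm _)).
  have [i|t ht] := has_sum_nonneg _ fb; first exact: cabs_ge0.
  exists (s - t); apply: has_sum_ext (has_sumB hs ht) => i.
  by rewrite /ofreal rmorphD addrK.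
have [s hs] := pos (fun i => complex.Re (f i)) (fun i => cabs_Re _).
have [t ht] := pos (fun i => complex.Im (f i)) (fun i => cabs_Im _).
exists (s + ('i%C : C) * t).
apply: has_sum_ext (has_sumD hs (has_sumZ ('i%C : C) ht)) => i.
by rewrite [RHS]complexE.
Qed.

Lemma has_sum_le (I : choiceType) (f : I -> C) s b :
  has_sum f s -> sums_le (fun i => cabs (f i)) b -> cabs s <= b.
Proof.
move=> fs fb; apply/ler_addgt0Pr => e /fs [A /(_ _ (fsubset_refl A))] h.
rewrite [s](_ : _ = \sum_(i <- A) f i - (\sum_(i <- A) f i - s)); last by ring.
rewrite (le_trans (cabsB _ _)) // lerD //; last exact: ltW.
by rewrite (le_trans (cabs_sum _ _ _)) //; exact: fb.
Qed.

(** Beyond a finite set of indices, a single term is the difference of two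
    finite sums that are both close to the limit. *)
Lemma has_sum_bounded (I : choiceType) (f : I -> C) s :
  has_sum f s -> exists b, forall i, cabs (f i) <= b.
Proof.
move=> /(_ 1 ltr01) [A hA]; exists (2 + \sum_(i <- A) cabs (f i)) => i.
have [iA|iA] := boolP (i \in A).
  rewrite (big_fsetD1 i) //= addrCA lerDl addr_ge0 ?sumr_ge0 // => j _.
  exact: cabs_ge0.
apply: (@le_trans _ _ 2); last by rewrite lerDl sumr_ge0 // => j _; exact: cabs_ge0.
have := hA _ (fsubsetU1 i A); rewrite big_fsetU1 //= => h1.
have h2 := hA _ (fsubset_refl A).
rewrite [f i](_ : _ = (f i + \sum_(j <- A) f j - s) - (\sum_(j <- A) f j - s));
  last by ring.
rewrite (le_trans (cabsB _ _)) // (_ : 2 = 1 + 1); last by [].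
by rewrite lerD // ltW.
Qed.

(** Indices that [h] misses contribute nothing, so a finite set of indices can
    be replaced by its preimage under [h]. *)
Lemma has_sum_reindex (I J : choiceType) (h : J -> I) (f : I -> C) s :
  injective h -> (forall i, (forall j, h j != i) -> f i = 0) ->
  has_sum f s -> has_sum (fun j => f (h j)) s.
Proof.
move=> hinj f0 fs e /fs [A hA].
have finA : finite_set (h @^-1` [set` A]).
  by apply: finite_preimage => // i j _ _; exact: hinj.
exists (fset_set (h @^-1` [set` A])) => B AB.
have iB j : h j \in A -> j \in B.
  by move=> jA; apply: (fsubsetP AB); rewrite in_fset_set //; exact: mem_set.
have := hA _ (fsubsetUl A (h @` B)).
rewrite -(@big_fset_incl _ _ _ _ (h @` B)) ?fsubsetUr //; last first.
  move=> i; rewrite inE => /orP[iA iB'|->//]; apply: f0 => j.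
  by apply/eqP => hj; move/negP: iB'; apply; rewrite -hj in_imfset //= iB // hj iA.
by rewrite big_imfset //= => i j _ _; exact: hinj.
Qed.

Lemma big_fsetM (V : nmodType) (I J : choiceType) (A : {fset I}) (B : {fset J})
    (f : I * J -> V) :
  \sum_(p <- A `*` B) f p = \sum_(i <- A) \sum_(j <- B) f (i, j).
Proof. by rewrite /fsetM big_imfset2 //= => -[i j] [k l] _ _ /= [-> ->]. Qed.

Lemma sub_fsetM (I J : choiceType) (D : {fset I * J}) (A : {fset I}) (B : {fset J}) :
  [fset p.1 | p in D] `<=` A -> [fset p.2 | p in D] `<=` B -> D `<=` A `*` B.
Proof.
move=> DA DB; apply/fsubsetP => p pD; rewrite in_fsetM.
by rewrite (fsubsetP DA) ?(fsubsetP DB) //; apply/imfsetP; exists p.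
Qed.

(** For a finite set of rows containing those of a finite set [D] of pairs on
    which the double sum is nearly attained, the row sums are approximated by a
    finite rectangle that contains [D]. *)
Lemma has_sum_rows (I J : choiceType) (f : I * J -> C) (g : I -> C) s :
  has_sum f s -> (forall i, has_sum (fun j => f (i, j)) (g i)) -> has_sum g s.
Proof.
move=> fs fg e e0; have e2 : 0 < e / 2 by rewrite divr_gt0.
have [D hD] := fs _ e2; exists [fset p.1 | p in D] => A DA.
have gA := has_sum_sum A fg.
have [E hE] := gA _ e2.
have := hE _ (fsubsetUl E [fset p.2 | p in D]); set E' := E `|` _ => h1.
have := hD _ (sub_fsetM DA (fsubsetUr E _)); rewrite -/E' big_fsetM.
rewrite exchange_big /= => h2.
rewrite [X in cabs X](_ : _ = (\sum_(j <- E') \sum_(i <- A) f (i, j) - s) -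
   (\sum_(j <- E') \sum_(i <- A) f (i, j) - \sum_(i <- A) g i)); last by ring.
by rewrite (le_lt_trans (cabsB _ _)) // [e]splitr ltrD.
Qed.

(** Being absolutely summable, the family of all pairs has a sum, and both
    iterated sums are equal to it. *)
Lemma has_sum_swap (I J : choiceType) (f : I -> J -> C) (g : I -> C) (h : J -> C) b s :
  (forall (A : {fset I}) (B : {fset J}),
     \sum_(i <- A) \sum_(j <- B) cabs (f i j) <= b) ->
  (forall i, has_sum (f i) (g i)) -> (forall j, has_sum (f^~ j) (h j)) ->
  has_sum g s -> has_sum h s.
Proof.
move=> fb fg fh gs.
have [t ft] : exists t, has_sum (fun p : I * J => f p.1 p.2) t.
  apply: (@has_sum_exists _ _ b) => D.
  apply: le_trans (fb [fset p.1 | p in D] [fset p.2 | p in D]).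
  apply: (le_trans (ler_sum_fset _ (sub_fsetM (fsubset_refl _) (fsubset_refl _)))).
    by move=> p; exact: cabs_ge0.
  by rewrite big_fsetM.
have <- : t = s by apply: has_sum_unique gs; exact: has_sum_rows ft fg.
apply: (@has_sum_rows _ _ (fun q : J * I => f q.2 q.1)) => //.
apply: (@has_sum_reindex _ _ (fun q : J * I => (q.2, q.1)) (fun p => f p.1 p.2)) ft.
  by move=> [i j] [k l] [-> ->].
by move=> [i j] /(_ (j, i)); rewrite eqxx.
Qed.

End UnorderedSums.

(** * Multi-indices and monomials *)

Section MultiIndices.
Variable n : nat.
Local Notation I := (multiindex n).
Implicit Types K M J : I.

(** Every finite set of multi-indices lies in such a box, and sums over boxes
    can be computed one exponent at a time. *)
Definition mbox (m : nat) : {fset I} :=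
  [fset mwiden K | K in predT : pred {ffun 'I_n -> 'I_m.+1}].

Definition mbin M K : nat := \prod_(j < n) 'C(M j, K j).

Definition madd M K : I := [ffun j => (M j + K j)%N].

Definition msub M K : I := [ffun j => (M j - K j)%N].

Definition munit (j : 'I_n) : I := [ffun i => (i == j) : nat].

Definition midx0 : I := [ffun=> 0%N].

Lemma mwiden_inj m : injective (@mwiden n m).
Proof.
move=> K L /ffunP h; apply/ffunP => j; apply: val_inj.
by have := h j; rewrite !ffunE.
Qed.

Lemma mboxP m K : reflect (forall j, (K j <= m)%N) (K \in mbox m).
Proof.
apply: (iffP idP) => [/imfsetP[L _ ->] j|h]; first by rewrite ffunE -ltnS.
apply/imfsetP; exists [ffun j => inord (K j)] => //; apply/ffunP => j.
by rewrite !ffunE inordK // ltnS.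
Qed.

Lemma mbox_mono m m' : (m <= m')%N -> mbox m `<=` mbox m'.
Proof.
by move=> mm; apply/fsubsetP => K /mboxP h; apply/mboxP => j; exact: leq_trans mm.
Qed.

Lemma mem_mbox K : K \in mbox (mdeg K).
Proof. by apply/mboxP => j; rewrite /mdeg (bigD1 j) //= leq_addr. Qed.

Lemma sub_mbox (A : {fset I}) : exists m, A `<=` mbox m.
Proof.
exists (\sum_(K <- A) mdeg K)%N; apply/fsubsetP => K KA.
apply: (fsubsetP (mbox_mono _)) (mem_mbox K).
by rewrite (big_fsetD1 K) //= leq_addr.
Qed.

Lemma big_mbox (V : nmodType) m (f : I -> V) :
  \sum_(K <- mbox m) f K = \sum_(K : {ffun 'I_n -> 'I_m.+1}) f (mwiden K).
Proof.
rewrite /mbox big_imfset /=; last by move=> K L _ _; exact: mwiden_inj.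
by rewrite big_enum_cond /=; apply: eq_bigl.
Qed.

(** Reduces the binomial theorem and the geometric series in several variables
    to one variable. *)
Lemma big_mbox_prod (A : comNzRingType) m (g : 'I_n -> nat -> A) :
  \sum_(K <- mbox m) \prod_j g j (K j) = \prod_j \sum_(k < m.+1) g j k.
Proof.
rewrite big_mbox bigA_distr_bigA /=; apply: eq_bigr => K _.
by apply: eq_bigr => j _; rewrite ffunE.
Qed.

Lemma sum_binomial (A : comNzRingType) (u v : A) k m : (k <= m)%N ->
  \sum_(i < m.+1) 'C(k, i)%:R * v ^+ (k - i) * u ^+ i = (v + u) ^+ k.
Proof.
rewrite -ltnS => km; rewrite exprDn.
rewrite (big_ord_widen _ (fun i => v ^+ (k - i) * u ^+ i *+ 'C(k, i)) km).
rewrite [RHS]big_mkcond /=; apply: eq_bigr => i _.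
rewrite ltnS; case: leqP => ki; last by rewrite bin_small // !mul0r.
by rewrite -mulrA mulr_natl.
Qed.

Lemma mbinomial (A : comNzRingType) (v u : 'rV[A]_n) M m : M \in mbox m ->
  \sum_(K <- mbox m) (mbin M K)%:R * mpow v (msub M K) * mpow u K
  = mpow (v + u) M.
Proof.
move=> /mboxP Mm.
under eq_bigr => K _.
  rewrite /mbin natr_prod /mpow -!big_split /=.
  under eq_bigr => j _ do rewrite ffunE.
  over.
rewrite (big_mbox_prod m
  (fun j k => 'C(M j, k)%:R * v 0 j ^+ (M j - k) * u 0 j ^+ k)).
by apply: eq_bigr => j _; rewrite sum_binomial // mxE.
Qed.

Lemma mbin_out M K m : M \in mbox m -> K \notin mbox m -> mbin M K = 0%N.
Proof.
move=> /mboxP Mm Km.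
have [j hj] : exists j, (m < K j)%N.
  apply: contrapT => h; move/negP: Km; apply; apply/mboxP => j.
  by rewrite leqNgt; apply/negP => ?; apply: h; exists j.
by rewrite /mbin (bigD1 j) //= bin_small // (leq_ltn_trans (Mm j)).
Qed.

Lemma mpowD (A : comNzRingType) (a : 'rV[A]_n) M K :
  mpow a (madd M K) = mpow a M * mpow a K.
Proof.
by rewrite /mpow -big_split; apply: eq_bigr => j _ /=; rewrite ffunE exprD.
Qed.

Lemma mpow_scale (A : comNzRingType) (c : A) (a : 'rV[A]_n) K :
  mpow (c *: a) K = c ^+ mdeg K * mpow a K.
Proof.
rewrite /mpow /mdeg -prodrXr -big_split.
by apply: eq_bigr => j _ /=; rewrite mxE exprMn.
Qed.

Lemma mpow_unit (A : comNzRingType) (a : 'rV[A]_n) j : mpow a (munit j) = a 0 j.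
Proof.
rewrite /mpow (bigD1 j) //= big1 ?mulr1 ?ffunE ?eqxx ?expr1 // => i ij.
by rewrite ffunE (negbTE ij) expr0.
Qed.

Lemma mpow_midx0 (A : comNzRingType) (a : 'rV[A]_n) : mpow a midx0 = 1.
Proof. by rewrite /mpow big1 // => j _; rewrite ffunE expr0. Qed.

Lemma mpow0 (A : comNzRingType) K : mpow (0 : 'rV[A]_n) K = (K == midx0)%:R.
Proof.
case: eqP => [->|K0]; first by rewrite mpow_midx0.
have [j hj] : exists j, K j != 0%N.
  apply: contrapT => h; apply: K0; apply/ffunP => j; rewrite ffunE.
  by apply/eqP; apply: contrapT => /negP ?; apply: h; exists j.
by rewrite /mpow (bigD1 j) //= mxE expr0n (negbTE hj) mul0r.
Qed.

Lemma mbin_add_unit M j : mbin (madd M (munit j)) (munit j) = (M j).+1.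
Proof.
rewrite /mbin (bigD1 j) //= big1 ?muln1; last first.
  by move=> i ij; rewrite !ffunE (negbTE ij) bin0.
by rewrite !ffunE eqxx bin1 addn1.
Qed.

Lemma msub_madd M K : msub (madd M K) K = M.
Proof. by apply/ffunP => j; rewrite !ffunE addnK. Qed.

Lemma madd_inj K : injective (madd^~ K).
Proof. by move=> M L h; rewrite -(msub_madd M K) h msub_madd. Qed.

Lemma madd_sub M K : (forall j, (K j <= M j)%N) -> madd (msub M K) K = M.
Proof. by move=> h; apply/ffunP => j; rewrite !ffunE subnK. Qed.

Lemma mfact_gt0 K : (0 < mfact K)%N.
Proof. by apply: prodn_gt0 => j; exact: fact_gt0. Qed.

End MultiIndices.
Arguments midx0 {n}.

Section RealMonomials.
Variables (R : realFieldType) (n : nat).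
Implicit Types (x y : 'rV[R]_n) (K : multiindex n).

Lemma mpow_ge0 x K : (forall j, 0 <= x 0 j) -> 0 <= mpow x K.
Proof. by move=> x0; apply: prodr_ge0 => j _; rewrite exprn_ge0. Qed.

Lemma mpow_gt0 x K : (forall j, 0 < x 0 j) -> 0 < mpow x K.
Proof. by move=> x0; apply: prodr_gt0 => j _; rewrite exprn_gt0. Qed.

Lemma ler_mpow x y K : (forall j, 0 <= x 0 j <= y 0 j) -> mpow x K <= mpow y K.
Proof.
move=> xy; apply: ler_prod => j _; have /andP[x0 h] := xy j.
by rewrite exprn_ge0 //= lerXn2r // nnegrE // (le_trans x0).
Qed.

Lemma sum_geometric (q : R) m : 0 <= q < 1 -> \sum_(k < m) q ^+ k <= (1 - q)^-1.
Proof.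
move=> /andP[q0 q1]; have d0 : 0 < 1 - q by rewrite subr_gt0.
rewrite -[leRHS]mul1r ler_pdivlMr // mulrC -opprB mulNr -subrX1 opprB.
by rewrite lerBlDr lerDl exprn_ge0.
Qed.

End RealMonomials.

Lemma mgeometric (R : realType) n (q : R) : 0 <= q < 1 ->
  sums_le (fun K : multiindex n => q ^+ mdeg K) ((1 - q)^-1 ^+ n).
Proof.
move=> q01 A; have [m Am] := sub_mbox A; have /andP[q0 q1] := q01.
apply: le_trans (ler_sum_fset _ Am) _ => [K|]; first exact: exprn_ge0.
under eq_bigr do rewrite /mdeg -prodrXr.
rewrite (big_mbox_prod m (fun _ k => q ^+ k)) -[X in _ ^+ X]card_ord -prodr_const.
apply: ler_prod => j _; rewrite sumr_ge0 /=; last by move=> k _; exact: exprn_ge0.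
exact: sum_geometric.
Qed.
Arguments mgeometric {R} n {q}.

(** * Power series in several variables *)

Section PowerSeries.
Variables (R : realType) (n : nat).
Local Notation C := (Cplx R).
Local Notation I := (multiindex n).
Implicit Types (z w u : 'rV[C]_n) (x y r : 'rV[R]_n) (a c : I -> C).
Implicit Types (K M J : I) (F G : 'rV[C]_n -> C).

Definition vabs w : 'rV[R]_n := map_mx (@cabs R) w.

Lemma vabs_ge0 w j : 0 <= vabs w 0 j.
Proof. by rewrite mxE cabs_ge0. Qed.

Lemma cabs_mpow w K : cabs (mpow w K) = mpow (vabs w) K.
Proof.
by rewrite cabs_prod; apply: eq_bigr => j _; rewrite cabsX mxE.
Qed.

Definition odisc z r : set 'rV[C]_n := [set w | forall j, vabs (w - z) 0 j < r 0 j].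

Lemma odisc_center z r : (forall j, 0 < r 0 j) -> odisc z r z.
Proof. by move=> r0 j; rewrite subrr !mxE cabs0. Qed.

Lemma vabsD_le z w u j : vabs (u - z) 0 j <= vabs (w - z) 0 j + vabs (u - w) 0 j.
Proof.
rewrite !mxE [u 0 j - _](_ : _ = (w 0 j - z 0 j) + (u 0 j - w 0 j)); last by ring.
exact: cabsD.
Qed.

(** The power series with coefficients [a] converges absolutely in every
    polydisc with radii less than [r]; by comparison with a geometric series
    it is enough that its terms are bounded there. *)
Definition pconv a r : Prop :=
  forall x, (forall j, 0 <= x 0 j < r 0 j) ->
    exists b : R, forall K, cabs (a K) * mpow x K <= b.

Definition powser a z r F : Prop :=
  pconv a r /\
  forall w, odisc z r w -> has_sum (fun K => a K * mpow (w - z) K) (F w).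

(** Comparison with the geometric series of ratio [q] in each variable. *)
Lemma pconv_sums_geo a r (q : R) b : 0 <= q < 1 ->
  (forall j, 0 <= r 0 j) ->
  (forall K, cabs (a K) * mpow r K <= b) ->
  sums_le (fun K => cabs (a K) * mpow (q *: r) K) (b * (1 - q)^-1 ^+ n).
Proof.
move=> q01 r0 hb; have /andP[q0 _] := q01.
have b0 : 0 <= b.
  by apply: (le_trans _ (hb midx0)); rewrite mulr_ge0 ?cabs_ge0 ?mpow_ge0.
apply: sums_le_mono (sums_le_scale b0 (mgeometric n q01)) => K.
by rewrite mpow_scale mulrCA mulrC ler_wpM2r // exprn_ge0.
Qed.

Lemma exists_ratio x r : (forall j, 0 <= x 0 j < r 0 j) ->
  exists2 q : R, 0 <= q < 1 & forall j, x 0 j <= q * r 0 j.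
Proof.
move=> xr; exists (\big[Num.max/0]_j (x 0 j / r 0 j)).
  rewrite bigmax_ge_id /=; apply/bigmax_ltP; split => // j _.
  have /andP[x0 h] := xr j.
  by rewrite ltr_pdivrMr ?mul1r // (le_lt_trans x0).
move=> j; have /andP[x0 h] := xr j.
rewrite -ler_pdivrMr ?(le_lt_trans x0) //.
exact: (le_bigmax _ (fun j => x 0 j / r 0 j)).
Qed.

Lemma pconv_sums a r x : pconv a r -> (forall j, 0 <= x 0 j < r 0 j) ->
  exists b, sums_le (fun K => cabs (a K) * mpow x K) b.
Proof.
move=> ar xr; pose y : 'rV[R]_n := \row_j ((x 0 j + r 0 j) / 2).
have xy j : 0 <= x 0 j < y 0 j.
  by have := xr j; rewrite mxE => /andP[-> ?] /=; lra.
have yr j : 0 <= y 0 j < r 0 j.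
  have /andP[? ?] := xr j; rewrite mxE; apply/andP; split; lra.
have [b hb] := ar _ yr; have [q q01 xq] := exists_ratio xy.
exists (b * (1 - q)^-1 ^+ n).
have y0 j : 0 <= y 0 j by case/andP: (yr j).
apply: sums_le_mono (pconv_sums_geo q01 y0 hb) => K.
rewrite ler_wpM2l ?cabs_ge0 //; apply: ler_mpow => j.
by have /andP[-> _] := xr j; rewrite mxE /= xq.
Qed.

Lemma pconv_of_bound a r b : (forall j, 0 <= r 0 j) ->
  (forall K, cabs (a K) * mpow r K <= b) -> pconv a r.
Proof.
move=> r0 hb x xr; exists b => K; apply: (le_trans _ (hb K)).
rewrite ler_wpM2l ?cabs_ge0 //; apply: ler_mpow => j.
by have /andP[-> /ltW] := xr j.
Qed.

(** A partial sum of the binomial expansion of [(y + x) ^ M], whose terms are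
    nonnegative. *)
Lemma binomial_term_le (y x : 'rV[R]_n) M (B : {fset I}) :
  (forall j, 0 <= x 0 j) -> (forall j, 0 <= y 0 j) ->
  \sum_(K <- B) (mbin M K)%:R * mpow y (msub M K) * mpow x K <= mpow (y + x) M.
Proof.
move=> x0 y0; have [m] := sub_mbox (M |` B); rewrite fsubUset fsub1set => /andP[Mm Bm].
rewrite -(mbinomial y x Mm); apply: ler_sum_fset Bm => K.
by rewrite !mulr_ge0 ?mpow_ge0.
Qed.

(** The double family behind the re-expansion of a power series at another
    point is dominated by the series of [|a M| (y + x) ^ M]. *)
Lemma recenter_bound a (y x : 'rV[R]_n) b :
  (forall j, 0 <= x 0 j) -> (forall j, 0 <= y 0 j) ->
  sums_le (fun M => cabs (a M) * mpow (y + x) M) b ->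
  forall A B : {fset I}, \sum_(M <- A) \sum_(K <- B)
    cabs (a M) * ((mbin M K)%:R * mpow y (msub M K)) * mpow x K <= b.
Proof.
move=> x0 y0 hb A B; apply: (le_trans _ (hb A)); apply: ler_sum => M _.
under eq_bigr do rewrite -mulrA.
by rewrite -mulr_sumr ler_wpM2l ?cabs_ge0 // binomial_term_le.
Qed.

(** The [M]-th term of the series giving the [K]-th coefficient of the
    re-expansion at a point displaced by [v] from the centre. *)
Definition recoef a (v : 'rV[C]_n) K M : C :=
  a M * ((mbin M K)%:R * mpow v (msub M K)).

Lemma cabs_recoef a v K M :
  cabs (recoef a v K M) =
  cabs (a M) * ((mbin M K)%:R * mpow (vabs v) (msub M K)).
Proof. by rewrite !cabsM cabs_nat cabs_mpow. Qed.

(** Re-expansion at [w]: write [(u - z) ^ M = ((w - z) + (u - w)) ^ M], expand by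
    the binomial theorem and exchange the two summations, which
    [recenter_bound] permits. The last conclusion is the quantitative form by
    which bounds on the coefficients travel from one centre to another. *)
Lemma recenter a z r F w : powser a z r F -> odisc z r w ->
  exists c, [/\ powser c w (r - vabs (w - z)) F,
    forall K, has_sum (recoef a (w - z) K) (c K) &
    forall x b, (forall j, 0 <= x 0 j) ->
      sums_le (fun M => cabs (a M) * mpow (vabs (w - z) + x) M) b ->
      forall K, cabs (c K) * mpow x K <= b].
Proof.
move=> [ar aF] zw; set v := w - z; set y := vabs v.
have y0 j : 0 <= y 0 j by exact: vabs_ge0.
have xconv x : (forall j, 0 <= x 0 j < (r - y) 0 j) ->
    exists b, sums_le (fun M => cabs (a M) * mpow (y + x) M) b.
  move=> xr; apply: (pconv_sums ar) => j.
  have /andP[x0] := xr j; have := y0 j; rewrite !mxE => ? ?.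
  by apply/andP; split; lra.
have recoef_le x b K : (forall j, 0 <= x 0 j) ->
    sums_le (fun M => cabs (a M) * mpow (y + x) M) b ->
    sums_le (fun M => cabs (recoef a v K M * (ofreal (mpow x K)))) b.
  move=> x0 hb A; apply: (le_trans _ (recenter_bound x0 y0 hb A [fset K])).
  apply: ler_sum => M _; rewrite big_seq_fset1 cabsM cabs_recoef cabs_ofreal.
  by rewrite ger0_norm // mpow_ge0.
have [c hc] : exists c, forall K, has_sum (recoef a v K) (c K).
  suff h K : exists s, has_sum (recoef a v K) s.
    by have [c hc] := choice h; exists c.
  (* Any [x] with positive entries and [y + x < r] would do: the weight
     [mpow x K] is divided out afterwards. *)
  pose x : 'rV[R]_n := \row_j ((r 0 j - y 0 j) / 2).
  have x0 j : 0 < x 0 j by have := zw j; rewrite -/v -/y !mxE => ?; lra.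
  have [|b hb] := xconv x.
    move=> j; have := zw j; rewrite -/v -/y !mxE => ?; apply/andP; split; lra.
  have [s hs] := has_sum_exists (recoef_le x b K (fun j => ltW (x0 j)) hb).
  exists ((ofreal (mpow x K))^-1 * s); apply: has_sum_ext (has_sumZ _ hs) => M.
  rewrite mulrC mulfK // -cabs_eq0 cabs_ofreal normr_eq0.
  by rewrite gt_eqF // mpow_gt0.
have c_le x b : (forall j, 0 <= x 0 j) ->
    sums_le (fun M => cabs (a M) * mpow (y + x) M) b ->
    forall K, cabs (c K) * mpow x K <= b.
  move=> x0 hb K; have hs := has_sumZ (ofreal (mpow x K)) (hc K).
  rewrite mulrC -[mpow x K]ger0_norm ?mpow_ge0 // -cabs_ofreal -cabsM.
  apply: has_sum_le hs _; apply: sums_le_mono (recoef_le x b K x0 hb) => M.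
  by rewrite mulrC.
exists c; split=> //; split => [x xr|u wu].
  have [b hb] := xconv _ xr; exists b; apply: c_le => // j; by case/andP: (xr j).
pose f M K := recoef a v K M * mpow (u - w) K.
have uw0 j : 0 <= vabs (u - w) 0 j by exact: vabs_ge0.
have [|b hb] := xconv (vabs (u - w)).
  by move=> j; rewrite uw0 /=; exact: wu.
apply: (@has_sum_swap _ _ _ f (fun M => a M * mpow (u - z) M) _ b).
- move=> A B; apply: (le_trans _ (recenter_bound uw0 y0 hb A B)).
  apply: ler_sum => M _; apply: ler_sum => K _.
  by rewrite cabsM cabs_recoef cabs_mpow.
- move=> M; rewrite (_ : u - z = v + (u - w)); last by rewrite /v [RHS]addrC subrKA.
  rewrite -(mbinomial _ _ (mem_mbox M)) mulr_sumr.
  rewrite (eq_bigr (f M)); last by move=> K _; rewrite /f /recoef !mulrA.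
  apply: has_sum_fin => K Kout.
  by rewrite /f /recoef (mbin_out (mem_mbox M) Kout) mul0r mulr0 mul0r.
- move=> K; rewrite mulrC.
  apply: has_sum_ext (has_sumZ (mpow (u - w) K) (hc K)) => M.
  by rewrite mulrC.
- apply: aF => j; apply: (le_lt_trans (vabsD_le z w u j)).
  by have := wu j; rewrite -/v -/y !mxE ltrBrDl.
Qed.

End PowerSeries.

(** * Termwise differentiation *)

(** The form in which a power series exhibits its derivative: the remainder
    after the linear term is quadratic. *)
Lemma derive1_of_quadratic (R : realType) (f : Cplx R -> Cplx R) (c : Cplx R) (b rho : R) :
  0 < rho ->
  (forall t, cabs t < rho -> cabs (f t - f 0 - c * t) <= b * cabs t ^+ 2) ->
  derive1 f 0 = c.
Proof.
move=> rho0 hf; rewrite /derive1; apply/cvg_lim; first exact: norm_hausdorff.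
apply/cvgrPdist_lt => e e0.
have [d d0 ->] : exists2 d, 0 < d & e = ofreal d.
  exists (cabs e); last by rewrite -normE gtr0_norm.
  by rewrite lt_neqAle cabs_ge0 eq_sym cabs_eq0 gt_eqF.
have b1 : 0 < `|b| + 1 by rewrite ltr_wpDl.
pose m := Num.min rho (d / (`|b| + 1)).
have m0 : 0 < ofreal m by rewrite /ofreal ltcR lt_min rho0 divr_gt0.
exists (ofreal m) => //= h; rewrite /ball_ /= sub0r normrN normE /ofreal ltcR.
rewrite lt_min addr0 => /andP[hrho hd] h0; rewrite normE ltcR.
have hpos : 0 < cabs h by rewrite lt_neqAle cabs_ge0 eq_sym cabs_eq0 h0.
rewrite (_ : c - _ = - (h^-1 * (f h - f 0 - c * h))); last first.
  by rewrite mulrBr mulrCA mulVf // mulr1 opprB.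
rewrite cabsN cabsM cabsV mulrC ltr_pdivrMr //.
apply: (le_lt_trans (hf _ hrho)).
rewrite expr2 mulrA ltr_pM2r //.
apply: le_lt_trans (_ : (`|b| + 1) * cabs h < d); last by rewrite mulrC -ltr_pdivlMr.
by rewrite ler_wpM2r ?cabs_ge0 // ler_wpDr // ler_norm.
Qed.

Section Differentiation.
Variables (R : realType) (n : nat).
Local Notation C := (Cplx R).
Local Notation I := (multiindex n).
Implicit Types (z w u : 'rV[C]_n) (x y r : 'rV[R]_n) (a c : I -> C).
Implicit Types (K M J : I) (F G : 'rV[C]_n -> C) (j : 'I_n).

Lemma powser_center a z r F : powser a z r F -> (forall j, 0 < r 0 j) -> F z = a midx0.
Proof.
move=> [_ aF] r0; apply: has_sum_unique (aF _ (odisc_center z r0)) _.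
have -> : a midx0 = \sum_(K <- [fset (midx0 : I)]) a K * mpow (z - z) K.
  by rewrite big_seq_fset1 mpow_midx0 mulr1.
apply: has_sum_fin => K; rewrite inE => K0.
by rewrite subrr mpow0 (negbTE K0) mulr0.
Qed.

Lemma mpow_line (t : C) j K :
  mpow (t *: delta_mx 0 j : 'rV[C]_n) K =
  if [forall i, (i != j) ==> (K i == 0%N)] then t ^+ K j else 0.
Proof.
rewrite /mpow (bigD1 j) //= !mxE !eqxx mulr1.
case: ifPn => [/forallP h|].
  rewrite big1 ?mulr1 // => i ij; have := h i; rewrite ij => /eqP ->.
  by rewrite expr0.
rewrite negb_forall => /existsP[k].
rewrite negb_imply => /andP[ij Ki]; rewrite (bigD1 k) //= !mxE (negbTE ij).
by rewrite andbF mulr0 expr0n (negbTE Ki) mul0r mulr0.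
Qed.

(** Along a coordinate line the series reads
    [a 0 + a e_j t + O(t ^ 2)]: every further nonzero monomial has degree at
    least two in [t]. *)
Lemma partial_center a w r F j :
  powser a w r F -> (forall j, 0 < r 0 j) -> partial j F w = a (munit j).
Proof.
move=> aF r0; pose x : 'rV[R]_n := 2^-1 *: r.
have x0 i : 0 < x 0 i by rewrite mxE mulr_gt0.
have xr i : 0 <= x 0 i < r 0 i.
  by rewrite ltW //= mxE; have := r0 i => ?; lra.
have [b hb] := pconv_sums aF.1 xr.
apply: (@derive1_of_quadratic _ _ _ (b / x 0 j ^+ 2) (x 0 j)) => // t tx.
rewrite scale0r addr0 (powser_center aF r0).
have tw : odisc w r (w + t *: delta_mx 0 j).
  move=> i; rewrite addrAC subrr add0r !mxE.
  case: (i == j) / eqP => [->|_]; last by rewrite andbF mulr0 cabs0 r0.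
  by rewrite !eqxx mulr1 (lt_trans tx) //; case/andP: (xr j).
have := aF.2 _ tw; rewrite addrAC subrr add0r => hs.
pose S : {fset I} := [fset midx0; munit j].
pose g K := if K \in S then a K * mpow (t *: delta_mx 0 j : 'rV[C]_n) K else 0.
have hg : has_sum g (a midx0 + a (munit j) * t).
  have -> : a midx0 + a (munit j) * t = \sum_(K <- S) g K.
    rewrite /S big_fsetU1 /=; last first.
      rewrite inE; apply/eqP => /ffunP/(_ j); by rewrite !ffunE eqxx.
    rewrite big_seq_fset1 /g !inE !eqxx orbT mpow_midx0 mulr1 mpow_unit !mxE.
    by rewrite !eqxx mulr1.
  by apply: has_sum_fin => K; rewrite /g => /negbTE ->.
rewrite -addrA -opprD; apply: has_sum_le (has_sumB hs hg) _.
have -> : b / x 0 j ^+ 2 * cabs t ^+ 2 = (cabs t / x 0 j) ^+ 2 * b.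
  by rewrite expr_div_n; ring.
apply: sums_le_mono (sums_le_scale (sqr_ge0 _) hb) => K.
have bound_ge0 : 0 <= (cabs t / x 0 j) ^+ 2 * (cabs (a K) * mpow x K).
  apply: mulr_ge0; first exact: sqr_ge0.
  by rewrite mulr_ge0 ?cabs_ge0 // mpow_ge0 // => i; rewrite ltW.
rewrite /g; case: ifPn => [_|KS]; first by rewrite subrr cabs0.
rewrite subr0 mpow_line; case: ifPn => [/forallP h|_]; last by rewrite mulr0 cabs0.
have h' i : i != j -> K i = 0%N by move=> ij; have := h i; rewrite ij => /eqP.
have Kj : (1 < K j)%N.
  rewrite ltnNge; apply: contra KS; rewrite leq_eqVlt ltnS leqn0 !inE.
  move=> /orP[|] /eqP Kj; apply/orP; [right|left]; apply/eqP/ffunP => i.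
    by rewrite ffunE; case: (i == j) / eqP => [->//|/eqP /h'].
  by rewrite ffunE; case: (i == j) / eqP => [->//|/eqP /h'].
rewrite cabsM cabsX [leRHS]mulrCA ler_wpM2l ?cabs_ge0 //.
rewrite /mpow (bigD1 j) //= big1 ?mulr1; last by move=> i /h' ->; rewrite expr0.
rewrite -(subnK Kj) [in leRHS]exprD mulrCA -exprMn divfK ?gt_eqF // exprD.
rewrite ler_wpM2r ?sqr_ge0 // lerXn2r ?nnegrE ?cabs_ge0 // ltW //.
Qed.

Definition dcoef j a K : C := (K j).+1%:R * a (madd K (munit j)).

(** At every [w] of the polydisc, [partial_center] reads the derivative off the
    re-expansion at [w], where it is the coefficient of index [e_j]; the
    convergence with the same radii rests on [(k + 1) x ^ k h <= (x + h) ^ (k + 1)]. *)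
Lemma powser_partial a z r F j :
  powser a z r F -> powser (dcoef j a) z r (partial j F).
Proof.
move=> aF; split => [x xr|w zw].
  pose h : 'rV[R]_n := \row_i ((r 0 i - x 0 i) / 2).
  have h0 i : 0 < h 0 i by have /andP[_] := xr i; rewrite mxE => ?; lra.
  have [|b hb] := aF.1 (x + h).
    by move=> i; have /andP[? ?] := xr i; rewrite !mxE; apply/andP; split; lra.
  have x0 i : 0 <= x 0 i by case/andP: (xr i).
  exists (b / h 0 j) => K; rewrite ler_pdivlMr //.
  apply: (le_trans _ (hb (madd K (munit j)))).
  have := binomial_term_le (madd K (munit j)) [fset munit j] (fun i => ltW (h0 i)) x0.
  rewrite big_seq_fset1 mbin_add_unit msub_madd mpow_unit => hh.
  rewrite /dcoef cabsM cabs_nat [leLHS](_ : _ = cabs (a (madd K (munit j))) *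
    ((K j).+1%:R * mpow x K * h 0 j)); last by ring.
  by rewrite ler_wpM2l ?cabs_ge0.
have [c [cF hc _]] := recenter aF zw.
have rw i : 0 < (r - vabs (w - z)) 0 i.
  by have := zw i; rewrite [in X in _ -> X]mxE [in X in _ -> X]mxE subr_gt0.
rewrite (partial_center j cF rw).
apply: has_sum_ext (has_sum_reindex (@madd_inj _ (munit j)) _ (hc (munit j))).
  move=> K; rewrite /recoef mbin_add_unit msub_madd /dcoef; ring.
move=> M hM; rewrite /recoef; suff -> : mbin M (munit j) = 0%N.
  by rewrite mul0r mulr0.
rewrite /mbin (bigD1 j) //= ffunE eqxx bin1.
suff -> : M j = 0%N by [].
apply/eqP; rewrite -leqn0 leqNgt; apply/negP => Mj.
have /eqP[] := hM (msub M (munit j)); apply: madd_sub => i; rewrite ffunE.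
by case: (i == j) / eqP => [->|].
Qed.

Definition addon j k K : I := [ffun i => (K i + (i == j) * k)%N].

Lemma powser_iter_partial a z r F j k : powser a z r F ->
  powser (fun K => ((K j + k) ^_ k)%:R * a (addon j k K)) z r (iter k (partial j) F).
Proof.
move=> aF; elim: k => [|k IH].
  rewrite /= (_ : (fun K => _) = a) //; apply/funext => K.
  rewrite ffactn0 mul1r; congr a; apply/ffunP => i.
  by rewrite ffunE muln0 addn0.
have := powser_partial j IH.
rewrite /= (_ : dcoef j _ =
  fun K => ((K j + k.+1) ^_ k.+1)%:R * a (addon j k.+1 K)) //.
apply/funext => K; rewrite /dcoef mulrA -natrM ffactnSr; congr (_%:R * a _).
  rewrite !ffunE eqxx addn1 addSnnS mulnC; congr (_ * _)%N.
  by rewrite -addSnnS addnK.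
by apply/ffunP => i; rewrite !ffunE; case: (i == j); rewrite ?mul1n ?mul0n -addnA.
Qed.

(** The coefficients of the series of [F^(K) / K!], given those of [F]. *)
Definition ncoef K a J : C := (mbin (madd J K) K)%:R * a (madd J K).

(** Stated for the list of variables already differentiated, as [mderiv] runs
    through the variables one after the other. *)
Lemma powser_foldr a z r F K (s : seq 'I_n) : uniq s -> powser a z r F ->
  powser (fun J => (\prod_(j <- s) (J j + K j) ^_ (K j))%:R *
                   a [ffun i => (J i + (i \in s) * K i)%N])
    z r (foldr (fun j G => iter (K j) (partial j) G) F s).
Proof.
move=> us aF; elim: s us => [_|j s IH /= /andP[js us]].
  rewrite /= (_ : (fun K => _) = a) //; apply/funext => J.
  rewrite big_nil mul1r; congr a; apply/ffunP => i.
  by rewrite ffunE addn0.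
have := powser_iter_partial j (K j) (IH us).
rewrite (_ : (fun J : I => _) = (fun J => (\prod_(j <- j :: s) (J j + K j) ^_ (K j))%:R *
     a [ffun i => (J i + (i \in j :: s) * K i)%N])) //.
apply/funext => J; rewrite mulrA -natrM big_cons; congr (_%:R * a _).
  congr (_ * _)%N; apply: eq_big_seq => i si; rewrite ffunE.
  case: (i == j) / eqP => [ij|_]; last by rewrite addn0.
  by move: js; rewrite -ij si.
apply/ffunP => i; rewrite !ffunE inE.
case: (i == j) / eqP => [->|_]; first by rewrite (negbTE js) /= !mul1n addn0.
by rewrite addn0.
Qed.

Definition tcoef F z K : C := mderiv K F z / (mfact K)%:R.

Lemma mfactC_neq0 K : (mfact K)%:R != 0 :> C.
Proof. by rewrite pnatr_eq0 -lt0n mfact_gt0. Qed.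

Lemma powser_deriv a z r F K : powser a z r F ->
  powser (ncoef K a) z r (fun w => tcoef F w K).
Proof.
move=> /(powser_foldr K (enum_uniq 'I_n)) [hc hF]; set d := (fun J => _) in hc hF.
have dE J : ncoef K a J = (mfact K)%:R^-1 * d J.
  rewrite /ncoef /d mulrA (_ : [ffun i => _] = madd J K); last first.
    by apply/ffunP => i; rewrite !ffunE mem_enum mul1n.
  congr (_ * _); apply: (mulfI (mfactC_neq0 K)); rewrite mulVKf ?mfactC_neq0 //.
  rewrite -natrM; congr _%:R; rewrite big_enum /= mulnC /mbin /mfact -big_split.
  by apply: eq_bigr => j _; rewrite ffunE /= bin_ffact.
split => [x xr|w zw].
  have [b hb] := hc x xr; exists ((mfact K)%:R^-1 * b) => J.
  by rewrite dE cabsM cabsV cabs_nat -mulrA ler_wpM2l ?invr_ge0.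
rewrite /tcoef mulrC; apply: has_sum_ext (has_sumZ _ (hF _ zw)) => J.
by rewrite dE mulrA.
Qed.

Lemma tcoef_center a z r F K : powser a z r F -> (forall j, 0 < r 0 j) ->
  tcoef F z K = a K.
Proof.
move=> aF r0; rewrite (powser_center (powser_deriv K aF) r0) /ncoef.
have -> : madd midx0 K = K by apply/ffunP => j; rewrite !ffunE.
by rewrite /mbin big1 ?mul1r // => j _; rewrite binn.
Qed.

End Differentiation.

(** * Taylor expansions on polydiscs *)

(** The supremum of the points of the unit interval where [P] holds inherits
    [P] from nearby points, and passes it on to larger ones unless it is 1. *)
Lemma unit_interval_ind (R : realType) (P : R -> Prop) :
  P 0 ->
  (forall s, 0 <= s <= 1 -> exists2 d, 0 < d & forall t t', 0 <= t <= 1 ->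
     0 <= t' <= 1 -> `|t - s| < d -> `|t' - s| < d -> P t -> P t') ->
  P 1.
Proof.
move=> P0 Ploc; pose E := [set t | 0 <= t <= 1 /\ P t].
have E0 : E 0 by split => //; rewrite lexx ler01.
have Eub : ubound E 1 by move=> t [/andP[]].
have supE : has_sup E by split; [exists 0|exists 1].
have s01 : 0 <= sup E <= 1.
  by rewrite ub_le_sup ?ge_sup //; [exists 0|exists 1].
have [d d0 hd] := Ploc _ s01.
have [t Et tsup] := sup_adherent d0 supE.
have tle : t <= sup E by apply: ub_le_sup => //; exists 1.
have td : `|t - sup E| < d by rewrite distrC ger0_norm ?subr_ge0 // ltrBlDr -ltrBlDl.
have prop u : 0 <= u <= 1 -> `|u - sup E| < d -> P u.
  by move=> u01 ud; apply: (hd t u) => //; case: Et.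
have /andP[s0 s1] := s01.
pose u := Num.min 1 (sup E + d / 2).
have u01 : 0 <= u <= 1.
  by rewrite /u le_min ler01 ge_min lexx /= andbT addr_ge0 // divr_ge0 // ltW.
have su : sup E <= u by rewrite le_min s1 lerDl divr_ge0 // ltW.
have Pu : P u.
  apply: prop => //; rewrite ger0_norm ?subr_ge0 // ltrBlDl.
  by rewrite gt_min ltrD2l [X in _ || (_ < X)]splitr ltrDl divr_gt0 ?orbT.
have : u <= sup E by apply: ub_le_sup; [exists 1|split].
rewrite ge_min => /orP[s1'|]; last by rewrite gerDl leNgt divr_gt0.
have <- : sup E = 1 by apply/eqP; rewrite eq_le s1.
by apply: prop => //; rewrite subrr normr0.
Qed.

Section Taylor.
Variables (R : realType) (n : nat).
Local Notation C := (Cplx R).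
Local Notation I := (multiindex n).
Implicit Types (z w u : 'rV[C]_n) (x y r : 'rV[R]_n) (a c : I -> C).
Implicit Types (K M J : I) (F G : 'rV[C]_n -> C) (j : 'I_n).

Lemma subrvE x y j : (x - y) 0 j = x 0 j - y 0 j.
Proof. by rewrite mxE mxE. Qed.

Definition analytic_at F z : Prop :=
  exists2 rho : R, 0 < rho & exists a, powser a z (const_mx rho) F.

Lemma powser_tcoef a z r F : powser a z r F -> (forall j, 0 < r 0 j) ->
  powser (tcoef F z) z r F.
Proof.
move=> aF r0; rewrite (_ : tcoef F z = a) //; apply/funext => K.
exact: tcoef_center aF r0.
Qed.

Lemma odisc_gt0 z r w : odisc z r w -> forall j, 0 < (r - vabs (w - z)) 0 j.
Proof. by move=> zw j; have := zw j; rewrite -subr_gt0 !mxE. Qed.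

Lemma powser_at a z r F w : powser a z r F -> odisc z r w ->
  [/\ powser (tcoef F w) w (r - vabs (w - z)) F,
      forall K, has_sum (recoef a (w - z) K) (tcoef F w K) &
      forall x b, (forall j, 0 <= x 0 j) ->
        sums_le (fun M => cabs (a M) * mpow (vabs (w - z) + x) M) b ->
        forall K, cabs (tcoef F w K) * mpow x K <= b].
Proof.
move=> aF zw; have [c [cF hc hb]] := recenter aF zw.
have r0 := odisc_gt0 zw.
rewrite (_ : tcoef F w = c) //; apply/funext => K.
exact: tcoef_center cF r0.
Qed.

Lemma powser_sub a z r r' F : (forall j, r' 0 j <= r 0 j) ->
  powser a z r F -> powser a z r' F.
Proof.
move=> rr [ar aF]; split => [x xr|w zw].
  by apply: ar => j; have /andP[-> /lt_le_trans] := xr j; apply.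
by apply: aF => j; exact: lt_le_trans (zw j) (rr j).
Qed.

(** The coefficients at [w] are given by the same series in the coefficients
    at [z] for both functions. *)
Lemma tcoef_propagate z r F G w :
  powser (tcoef F z) z r F -> powser (tcoef G z) z r G -> odisc z r w ->
  tcoef F z = tcoef G z -> tcoef F w = tcoef G w.
Proof.
move=> hF hG zw e; apply/funext => K.
have [_ hFK _] := powser_at hF zw; have [_ hGK _] := powser_at hG zw.
by apply: has_sum_unique (hFK K) _; rewrite e.
Qed.

Lemma exists_small (v r : 'rV[R]_n) : (forall j, 0 <= v 0 j) ->
  (forall j, 0 < r 0 j) -> exists2 d : R, 0 < d & forall j, d * v 0 j < r 0 j.
Proof.
move=> v0 r0; pose g j := r 0 j / (v 0 j + 1).
have v1 j : 0 < v 0 j + 1 by rewrite ltr_wpDl.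
exists (\big[Num.min/1]_j g j).
  by apply/bigmin_gtP; split => // j _; rewrite divr_gt0.
move=> j; have h : \big[Num.min/1]_j g j <= g j by exact: bigmin_le_cond.
apply: (@le_lt_trans _ _ (g j * v 0 j)); first by rewrite ler_wpM2r.
by rewrite /g mulrAC ltr_pdivrMr // ltr_pM2l // ltrDl.
Qed.

(** Identity theorem: along the segment from the centre to a point of the
    polydisc, [F] and the sum [G] of its Taylor series at the centre keep having
    the same Taylor coefficients, because near each point of the segment both
    are sums of power series and [tcoef_propagate] applies. *)
Lemma taylor_polydisc z r F : (forall j, 0 < r 0 j) ->
  (forall w, odisc z r w -> analytic_at F w) ->
  pconv (tcoef F z) r -> powser (tcoef F z) z r F.
Proof.
move=> r0 Fan cv.
have [G hG] : exists G, powser (tcoef F z) z r G.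
  suff h w : exists s, odisc z r w -> has_sum (fun K => tcoef F z K * mpow (w - z) K) s.
    by have [G hG] := choice h; exists G.
  have [zw|] := pselect (odisc z r w); last by exists 0.
  have [|b hb] := pconv_sums (x := vabs (w - z)) cv.
    by move=> j; rewrite vabs_ge0 /=; exact: zw.
  have [|s hs] := @has_sum_exists R _ (fun K => tcoef F z K * mpow (w - z) K) b.
    by apply: sums_le_mono hb => K; rewrite cabsM cabs_mpow.
  by exists s.
have eqz : tcoef F z = tcoef G z.
  by apply/funext => K; rewrite (tcoef_center K hG r0).
split => // w zw.
suff e : tcoef F w = tcoef G w.
  have [rho rho0 [a aF]] := Fan w zw.
  have -> : F w = G w.
    have rho0' j : 0 < (const_mx rho : 'rV[R]_n) 0 j by rewrite mxE.
    rewrite (powser_center (powser_tcoef aF rho0') rho0') e.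
    by have [h _ _] := powser_at hG zw; rewrite (powser_center h (odisc_gt0 zw)).
  exact: hG.2.
pose p (t : R) := z + ofreal t *: (w - z).
have vp t t' j : vabs (p t - p t') 0 j = `|t - t'| * vabs (w - z) 0 j.
  rewrite -(cabs_ofreal (t - t')) /p opprD addrACA subrr add0r -scalerBl.
  by rewrite [RHS]mulrC !mxE cabsM mulrC /ofreal rmorphB.
have p0 : p 0 = z by rewrite /p scale0r addr0.
have p1 : p 1 = w by rewrite /p scale1r addrC subrK.
have zp t : 0 <= t <= 1 -> odisc z r (p t).
  move=> /andP[t0 t1] j; rewrite -p0 vp subr0 ger0_norm //.
  by apply: le_lt_trans (zw j); rewrite ler_piMl // vabs_ge0.
rewrite -p1; apply: (@unit_interval_ind R (fun t => tcoef F (p t) = tcoef G (p t))).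
  by rewrite p0.
move=> s s01; have [rho rho0 [a aF]] := Fan _ (zp s s01).
have [hGs _ _] := powser_at hG (zp s s01).
pose r' : 'rV[R]_n := \row_j Num.min rho ((r - vabs (p s - z)) 0 j).
have r'0 j : 0 < r' 0 j by rewrite mxE lt_min rho0 (odisc_gt0 (zp s s01)).
have hF' : powser a (p s) r' F.
  by apply: powser_sub aF => j; rewrite !mxE ge_min lexx.
have hG' : powser (tcoef G (p s)) (p s) r' G.
  by apply: powser_sub hGs => j; rewrite !mxE ge_min lexx orbT.
(* In units of [|w - z|], the point [p t] will be within [d / 3] of [p s], and
   [p t'] within [2 d / 3] of [p t]: in all less than the radii [r']. *)
have [d d0 hd] := exists_small (vabs_ge0 (w - z)) r'0.
have d3 : 0 < d / 3 by rewrite divr_gt0.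
exists (d / 3); first exact: d3.
move=> t t' t01 t'01 ts t's.
have near_s (q : R) : `|q - s| < d / 3 -> odisc (p s) r' (p q).
  move=> us j; rewrite vp; apply: le_lt_trans (hd j).
  by rewrite ler_wpM2r ?vabs_ge0 //; lra.
have [hFt _ _] := powser_at hF' (near_s _ ts).
have [hGt _ _] := powser_at hG' (near_s _ ts).
apply: tcoef_propagate hFt hGt _ => j.
rewrite vp subrvE vp ltrBrDr -mulrDl.
apply: le_lt_trans (hd j); rewrite ler_wpM2r ?vabs_ge0 //.
rewrite (_ : t' - t = (t' - s) - (t - s)); last by ring.
by apply: (le_trans (lerD (ler_normB _ _) (lexx _))); lra.
Qed.

End Taylor.

(** * Cauchy estimates *)

(** In characteristic zero the polynomial [X^q - 1] has [q] distinct roots. *)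
Lemma exists_primitive_root (F : numClosedFieldType) (q : nat) : (0 < q)%N ->
  exists w : F, q.-primitive_root w.
Proof.
move=> q0; have [s Ds] := closed_field_poly_normal ('X^q - 1 : {poly F}).
rewrite (monicP _) ?monicXnsubC // scale1r in Ds.
have s1 : all q.-unity_root s.
  by apply/allP => w; rewrite -root_prod_XsubC -Ds.
have us : uniq s.
  by rewrite -separable_prod_XsubC -Ds separable_Xn_sub_1 // pnatr_eq0 -lt0n.
have ss : (q <= size s)%N.
  by rewrite -ltnS -(size_prod_XsubC s id) -Ds size_XnsubC.
by have /hasP[w _ hw] := has_prim_root q0 s1 us ss; exists w.
Qed.

Section Cauchy.
Variables (R : realType) (n : nat).
Local Notation C := (Cplx R).
Local Notation I := (multiindex n).
Implicit Types (z w u : 'rV[C]_n) (x y r : 'rV[R]_n) (a c : I -> C).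
Implicit Types (K M J : I) (F G : 'rV[C]_n -> C) (j : 'I_n).

Lemma cabs_root_of_unity (w : C) q : (0 < q)%N -> w ^+ q = 1 -> cabs w = 1.
Proof.
move=> q0 /(congr1 (@cabs R)); rewrite cabsX cabs1 => /eqP.
by rewrite pexpr_eq1 ?cabs_ge0 // => /eqP.
Qed.

Lemma sum_powers_root_of_unity (w : C) q : w ^+ q = 1 ->
  \sum_(i < q) w ^+ i = if w == 1 then q%:R else 0.
Proof.
move=> wq; case: eqP => [->|/eqP w1].
  under eq_bigr do rewrite expr1n.
  by rewrite sumr_const card_ord.
apply/eqP; have := subrX1 w q; rewrite wq subrr => /esym/eqP.
by rewrite mulf_eq0 subr_eq0 (negbTE w1).
Qed.

Definition mcongr (q : nat) M K := [forall j, K j == M j %[mod q]].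

(** The discrete substitute for the integral over a torus: averaging [F] against
    a character over [q]-th roots of unity keeps exactly the terms whose
    exponents are congruent to those of [M] modulo [q]. *)
Lemma torus_average a z r F x A q M :
  powser a z r F -> (forall j, 0 <= x 0 j < r 0 j) ->
  (forall w, (forall j, vabs (w - z) 0 j <= x 0 j) -> cabs (F w) <= A) ->
  (0 < q)%N ->
  exists2 s, cabs s <= A & has_sum (fun K => if mcongr q M K
     then a K * ofreal (mpow x K) else 0) s.
Proof.
move=> aF xr FA q0; have [zeta hz] := exists_primitive_root C q0.
have zq : zeta ^+ q = 1 by exact: prim_expr_order.
have z1 : cabs zeta = 1 by exact: cabs_root_of_unity zq.
have z0 : zeta != 0 by rewrite -cabs_eq0 z1 oner_eq0.
pose w (th : {ffun 'I_n -> 'I_q}) : 'rV[C]_n :=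
  \row_j (ofreal (x 0 j) * zeta ^+ th j).
pose ch (th : {ffun 'I_n -> 'I_q}) : C := \prod_j (zeta ^+ M j)^-1 ^+ th j.
have vw th j : vabs (z + w th - z) 0 j = x 0 j.
  rewrite addrAC subrr add0r !mxE cabsM cabsX z1 expr1n mulr1 cabs_ofreal.
  by rewrite ger0_norm //; case/andP: (xr j).
have ch1 th : cabs (ch th) = 1.
  rewrite cabs_prod big1 // => j _.
  by rewrite cabsX cabsV cabsX z1 expr1n invr1 expr1n.
have hs th : has_sum (fun K => ch th * (a K * mpow (w th) K)) (ch th * F (z + w th)).
  apply: has_sumZ; rewrite -[w th in X in has_sum X](addKr z) addrC.
  by apply: aF.2 => j; rewrite vw; case/andP: (xr j).
pose N : C := (q ^ n)%:R.
have N0 : N != 0 by rewrite pnatr_eq0 -lt0n expn_gt0 q0.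
have cN : cabs N = (q ^ n)%:R by exact: cabs_nat.
exists (N^-1 * \sum_th ch th * F (z + w th)).
  rewrite cabsM cabsV cN mulrC ler_pdivrMr ?ltr0n ?expn_gt0 ?q0 //.
  apply: (le_trans (cabs_sum _ _ _)).
  have <- : #|{ffun 'I_n -> 'I_q}| = (q ^ n)%N by rewrite card_ffun !card_ord.
  rewrite mulr_natr -sumr_const; apply: ler_sum => th _.
  by rewrite cabsM ch1 mul1r; apply: FA => j; rewrite vw.
apply: has_sum_ext (has_sumZ N^-1 (has_sum_sum (index_enum _) hs)) => K.
transitivity (N^-1 * (a K * ofreal (mpow x K) *
   \sum_(th : {ffun 'I_n -> 'I_q}) \prod_j (zeta ^+ K j / zeta ^+ M j) ^+ th j)).
  congr (_ * _); rewrite mulr_sumr; apply: eq_bigr => th _.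
  rewrite mulrC -!mulrA; congr (_ * _).
  rewrite /mpow /ch /ofreal rmorph_prod -!big_split; apply: eq_bigr => j _ /=.
  rewrite mxE !exprMn rmorphXn /= -[(zeta ^+ th j) ^+ _]exprM mulnC exprM.
  by rewrite mulrA.
have -> : \sum_(th : {ffun 'I_n -> 'I_q}) \prod_j (zeta ^+ K j / zeta ^+ M j) ^+ th j =
    \prod_j \sum_(i < q) (zeta ^+ K j / zeta ^+ M j) ^+ i.
  by rewrite bigA_distr_bigA.
have eqj j : \sum_(i < q) (zeta ^+ K j / zeta ^+ M j) ^+ i =
    if K j == M j %[mod q] then q%:R else 0.
  rewrite sum_powers_root_of_unity; last first.
    by rewrite exprMn exprVn -!exprM ![(_ * q)%N]mulnC !exprM zq !expr1n divr1.
  by rewrite -(eq_prim_root_expr hz) -subr_eq0 -(divff (expf_neq0 (M j) z0)) -mulrBl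
    mulf_eq0 invr_eq0 (negbTE (expf_neq0 _ z0)) orbF subr_eq0.
case: ifPn => [/forallP h|].
  rewrite (eq_bigr (fun=> q%:R)); last by move=> j _; rewrite eqj h.
  rewrite prodr_const card_ord -natrX mulrC mulfK //.
rewrite negb_forall => /existsP[k hk].
by rewrite (bigD1 k) //= eqj (negbTE hk) mul0r !mulr0.
Qed.

(** When [q] exceeds the entries of [M] and of a finite set [D] of multi-indices
    that carries almost all of the absolute sum, the only term of [D] that can
    survive in [torus_average] is the one of index [M]. *)
Theorem cauchy_estimate a z r F x A M :
  powser a z r F -> (forall j, 0 <= x 0 j < r 0 j) ->
  (forall w, (forall j, vabs (w - z) 0 j <= x 0 j) -> cabs (F w) <= A) ->
  cabs (a M) * mpow x M <= A.
Proof.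
move=> aF xr FA; apply/ler_addgt0Pr => e e0.
have x0 K : 0 <= mpow x K by apply: mpow_ge0 => j; case/andP: (xr j).
have e2 : 0 < e / 2 by rewrite divr_gt0.
have [b hb] := pconv_sums aF.1 xr.
have pos K : 0 <= cabs (a K) * mpow x K by rewrite mulr_ge0 ?cabs_ge0.
have [D hD] := sums_le_tail pos hb e2.
have [m] := sub_mbox (M |` D); rewrite fsubUset fsub1set => /andP[Mm Dm].
have [s sA hs] := torus_average M aF xr FA (ltn0Sn m).
set g := (fun K => _) in hs.
have [B hB] := hs _ e2.
have gM : g M = a M * ofreal (mpow x M).
  by rewrite /g (_ : mcongr _ _ _) //; apply/forallP => j.
have := hB _ (fsubsetU1 M B); rewrite (big_fsetD1 M) ?fset1U1 //= gM => h1.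
set T := \sum_(K <- _) g K in h1.
have hT : cabs T <= e / 2.
  apply: (le_trans (cabs_sum _ _ _)).
  set E := (_ `\ _)%fset.
  apply: (@le_trans _ _ (\sum_(K <- E `\` D) cabs (a K) * mpow x K)).
    rewrite -(big_fset_incl _ (fsubsetDl E D)).
      apply: ler_sum => K _; rewrite /g; case: ifP => _.
        by rewrite cabsM cabs_ofreal ger0_norm.
      by rewrite cabs0.
    move=> K KE; rewrite inE KE andbT negbK => KD; rewrite /g; case: ifPn => [/forallP h|_].
      have KM : K = M.
        apply/ffunP => j; have := h j.
        have hK : (K j < m.+1)%N by exact: (mboxP _ _ (fsubsetP Dm _ KD)).
        have hM : (M j < m.+1)%N by exact: (mboxP _ _ Mm).
        by rewrite !modn_small // => /eqP.
      by move: KE; rewrite /E KM !inE eqxx.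
    by rewrite cabs0.
  by apply/ltW/hD/fdisjointP => K KD; rewrite inE KD.
rewrite -[mpow x M]ger0_norm // -cabs_ofreal -cabsM.
rewrite [a M * _](_ : _ = (a M * ofreal (mpow x M) + T - s) - T + s); last by ring.
apply: (le_trans (cabsD _ _)); rewrite addrC lerD //.
by apply: (le_trans (cabsB _ _)); rewrite [e]splitr lerD // ltW.
Qed.

End Cauchy.

(** * Growth of Taylor coefficients *)

Lemma mpow_const (A : comNzRingType) n (c : A) (K : multiindex n) :
  mpow (const_mx c) K = c ^+ mdeg K.
Proof. by rewrite /mdeg -prodrXr; apply: eq_bigr => j _; rewrite mxE. Qed.

Section Growth.
Variables (R : realType) (n : nat).
Local Notation C := (Cplx R).
Local Notation I := (multiindex n).
Implicit Types (z w u : 'rV[C]_n) (K M J : I) (j : 'I_n) (S : R).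

Variables (F : 'rV[C]_n -> C) (r : 'rV[R]_n).

(** The quantities of the theorem with the weights [1 / L] frozen to [r]. *)
Definition wcoef w K : R := cabs (tcoef F w K) * mpow r K.

Definition low_le N w S : Prop := forall K, (mdeg K <= N)%N -> wcoef w K <= S.

Variables (z : 'rV[C]_n) (N : nat) (lam c : R).
(* The three control hypotheses are what bounded index gives when [r] is
   [1 / L z] and the entries of [L] vary by a factor at most [lam] on the
   polydisc of radii [r]. At the centre itself nothing is lost. *)
Hypothesis r0 : forall j, 0 < r 0 j.
Hypothesis lam1 : 1 <= lam.
Hypothesis c0 : 0 <= c.
Hypothesis Fan : forall w u, odisc z r w -> odisc w (lam^-1 *: r) u -> analytic_at F u.
Hypothesis ctrl : forall w S, odisc z r w -> low_le N w S ->
  forall J, wcoef w J <= c * lam ^+ mdeg J * S.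
Hypothesis ctrl_center : forall S, low_le N z S -> forall J, wcoef z J <= c * S.

(* [s] is the relative length of a step, a quarter of the radii [r / lam] on
   which the Taylor series at the points of the polydisc converge; [c1] is the
   growth factor of one step. *)
Let s : R := (4 * lam)^-1.
Let c1 : R := (4 * lam) ^+ N * (c * 2 ^+ n).

Let lam0 : 0 < lam. Proof. exact: lt_le_trans lam1. Qed.
Let s0 : 0 < s. Proof. by rewrite invr_gt0 mulr_gt0. Qed.
Let rge0 j : 0 <= r 0 j. Proof. exact: ltW. Qed.

Let wcoef_ge0 w K : 0 <= wcoef w K.
Proof. by rewrite mulr_ge0 ?cabs_ge0 ?mpow_ge0. Qed.

Let low_le_ge0 w S : low_le N w S -> 0 <= S.
Proof.
move=> h; apply: (le_trans (wcoef_ge0 w midx0)); apply: h.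
by rewrite /mdeg big1 // => j _; rewrite ffunE.
Qed.

(** The Taylor series at [w] converges with radii [r / lam] and represents [F];
    re-expand it at [w']. Since [|w' - w|] and the weights [s r] add up to at
    most half of [r / lam], what bounds the new coefficients is a geometric
    series of ratio [1 / 2] in each variable. *)
Lemma low_le_step w w' S : odisc z r w ->
  (forall j, vabs (w' - w) 0 j <= s * r 0 j) ->
  low_le N w S -> low_le N w' (c1 * S).
Proof.
move=> zw ww' hS K KN; have S0 := low_le_ge0 hS.
pose r' := lam^-1 *: r.
have r'0 j : 0 < r' 0 j by rewrite mxE mulr_gt0 ?invr_gt0.
have bound M : cabs (tcoef F w M) * mpow r' M <= c * S.
  rewrite mpow_scale mulrCA exprVn mulrC ler_pdivrMr ?exprn_gt0 //.
  by rewrite mulrAC; exact: ctrl.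
have Fw : powser (tcoef F w) w r' F.
  apply: taylor_polydisc => //; first by move=> u; exact: Fan.
  by apply: pconv_of_bound bound => j; exact: ltW.
have slam : s * lam = 4^-1 by rewrite /s invfM mulfVK // gt_eqF.
have sE : s = 4^-1 * lam^-1 by rewrite -slam mulfK // gt_eqF.
have near_w : odisc w r' w'.
  move=> j; apply: (le_lt_trans (ww' j)); rewrite mxE ltr_pM2r // sE.
  by rewrite gtr_pMl ?invr_gt0 // invf_lt1 // ltr1n.
have half : 0 <= (2^-1 : R) < 1 by apply/andP; split; lra.
have [_ _ /(_ (s *: r) (c * S * 2 ^+ n))] := powser_at Fw near_w.
have sr0 j : 0 <= (s *: r) 0 j by rewrite mxE mulr_ge0 // ltW.
move=> /(_ sr0) hb.
have : cabs (tcoef F w' K) * mpow (s *: r) K <= c * S * 2 ^+ n.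
  apply: hb; have := pconv_sums_geo half (fun j => ltW (r'0 j)) bound.
  rewrite (_ : (1 - 2^-1)^-1 = 2 :> R); last by field.
  apply: sums_le_mono => M; rewrite ler_wpM2l ?cabs_ge0 //; apply: ler_mpow => j.
  rewrite !mxE /= addr_ge0 ?cabs_ge0 //=; last by have := sr0 j; rewrite mxE.
  have := ww' j; rewrite !mxE sE; move: (r0 j) lam0; lra.
rewrite mpow_scale mulrCA exprVn -/(wcoef w' K) mulrC ler_pdivrMr ?exprn_gt0 ?mulr_gt0 //.
move=> /le_trans; apply.
rewrite /c1 [leRHS](_ : _ = c * S * 2 ^+ n * (4 * lam) ^+ N); last by ring.
rewrite ler_wpM2l ?mulr_ge0 ?exprn_ge0 // ler_weXn2l //.
by move: lam1; lra.
Qed.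

(** From the centre to any point of the polydisc there are [p] steps of relative
    length at most [s], whatever the point. *)
Lemma low_le_chain w S p : 4 * lam <= p%:R -> odisc z r w ->
  low_le N z S -> low_le N w (c1 ^+ p * S).
Proof.
move=> hp zw hS.
have p0 : 0 < p%:R :> R by apply: lt_le_trans hp; rewrite mulr_gt0.
pose g (i : nat) : 'rV[C]_n := z + ofreal (i%:R / p%:R) *: (w - z).
have vg (t : R) j : 0 <= t -> vabs (ofreal t *: (w - z)) 0 j = t * vabs (w - z) 0 j.
  by move=> t0; rewrite !mxE cabsM cabs_ofreal ger0_norm.
have gz i : (i <= p)%N -> odisc z r (g i).
  move=> ip j; rewrite /g addrAC subrr add0r vg ?divr_ge0 //.
  apply: le_lt_trans (zw j); rewrite ler_piMl ?vabs_ge0 //.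
  by rewrite ler_pdivrMr // mul1r ler_nat.
have step i : g i.+1 - g i = ofreal p%:R^-1 *: (w - z).
  rewrite /g opprD addrACA subrr add0r -scalerBl /ofreal -rmorphB; congr (_ *: _).
  by rewrite -mulrBl -addn1 natrD addrAC subrr add0r mul1r.
have chain i : (i <= p)%N -> low_le N (g i) (c1 ^+ i * S).
  elim: i => [_|i IH ip].
    by rewrite /g mul0r scale0r addr0 mul1r.
  rewrite exprS -mulrA; apply: low_le_step (IH (ltnW ip)); first exact/gz/ltnW.
  move=> j; rewrite step vg ?invr_ge0 //.
  apply: ler_pM; rewrite ?invr_ge0 ?vabs_ge0 //; last exact: ltW.
  by rewrite /s lef_pV2 ?posrE // mulr_gt0.
have := chain p (leqnn p).
by rewrite /g divff ?gt_eqF // scale1r addrC subrK.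
Qed.

(** The expansion at the centre reaches a fixed proportion [s] beyond the
    polydisc of radii [r]. On that polydisc [F^(K) / K!] is bounded by a multiple
    of [lam ^ |K|], by [low_le_chain]; the Cauchy estimate on the slightly smaller
    one, of radii [q r], turns this into a bound on
    [C(M, K) a_M q ^ |M - K|] for each [K <= M]. Multiply it by [(2 s) ^ |K|] and
    sum over [K]: the binomial theorem gives [(q + 2 s) ^ |M| = (1 + s) ^ |M|] on
    the left, and the factors [(2 s lam) ^ |K| = 2 ^ (- |K|)] have a finite sum on
    the right. *)
Theorem wcoef_decay S p : 4 * lam <= p%:R -> low_le N z S ->
  forall J, wcoef z J * (1 + s) ^+ mdeg J <= c * c1 ^+ p * 2 ^+ n * S.
Proof.
move=> hp hS M; pose A := c * c1 ^+ p * S.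
have S0 := low_le_ge0 hS.
have c10 : 0 <= c1 by rewrite !mulr_ge0 ?exprn_ge0 // mulr_ge0 // ltW.
have A0 : 0 <= A by rewrite !mulr_ge0 ?exprn_ge0.
have hA w K : odisc z r w -> wcoef w K <= A * lam ^+ mdeg K.
  move=> zw; apply: (le_trans (ctrl zw (low_le_chain hp zw hS) K)).
  by rewrite /A le_eqVlt; apply/orP; left; apply/eqP; ring.
have Fz : powser (tcoef F z) z r F.
  apply: taylor_polydisc => // [w zw|].
    by apply: (Fan zw); apply: odisc_center => j; rewrite mxE mulr_gt0 ?invr_gt0.
  exact: pconv_of_bound (ctrl_center hS).
have s4 : s <= 4^-1.
  by rewrite lef_pV2 ?posrE ?mulr_gt0 // ler_pMr.
pose q := 1 - s.
have q01 : 0 <= q < 1 by move: s0 s4 => ? ?; rewrite /q; apply/andP; split; lra.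
have /andP[q0 q1] := q01.
have term K : (mbin M K)%:R * (wcoef z M * q ^+ mdeg (msub M K)) <= A * lam ^+ mdeg K.
  have [KM|/existsNP[j /negP]] := pselect (forall j, (K j <= M j)%N); last first.
    rewrite -ltnNge => Kj; rewrite /mbin (bigD1 j) //= bin_small // mul0r.
    by rewrite mulr_ge0 // exprn_ge0 // ltW.
  have Kpos : 0 < mpow r K by exact: mpow_gt0.
  have := @cauchy_estimate _ _ _ z r (fun w => tcoef F w K) (q *: r)
     (A * lam ^+ mdeg K / mpow r K) (msub M K) (powser_deriv K Fz).
  rewrite /ncoef madd_sub // mpow_scale cabsM cabs_nat => /(_ _ _)/wrap[].
    by move=> j; rewrite mxE mulr_ge0 //= gtr_pMl.
    move=> w hw; rewrite ler_pdivlMr //; apply: hA => j.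
    by apply: (le_lt_trans (hw j)); rewrite mxE gtr_pMl.
  rewrite ler_pdivlMr // => h; apply: le_trans h.
  rewrite /wcoef -[in mpow r M](madd_sub KM) mpowD le_eqVlt; apply/orP; left; apply/eqP.
  by ring.
have twos : lam * (2 * s) = 2^-1 by rewrite /s; field; rewrite gt_eqF.
have half : 0 <= (2^-1 : R) < 1 by apply/andP; split; lra.
rewrite (_ : 1 + s = q + 2 * s); last by rewrite /q; ring.
rewrite -mpow_const.
have -> : const_mx (q + 2 * s) = const_mx q + const_mx (2 * s) :> 'rV[R]_n.
  by apply/matrixP => i j; rewrite !mxE.
rewrite -(mbinomial _ _ (mem_mbox M)) mulr_sumr.
apply: (@le_trans _ _ (\sum_(K <- mbox n (mdeg M)) A * 2^-1 ^+ mdeg K)).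
  apply: ler_sum => K _; rewrite !mpow_const.
  rewrite -twos [in leRHS]exprMn [leRHS]mulrA [leLHS](_ : _ = (mbin M K)%:R *
    (wcoef z M * q ^+ mdeg (msub M K)) * (2 * s) ^+ mdeg K); last by ring.
  by rewrite ler_wpM2r // exprn_ge0 // mulr_ge0 // ltW.
rewrite -mulr_sumr [leRHS](_ : _ = A * 2 ^+ n); last by rewrite /A; ring.
rewrite ler_wpM2l //; have := mgeometric n half (mbox n (mdeg M)).
by rewrite (_ : (1 - 2^-1)^-1 = 2 :> R) //; field.
Qed.

End Growth.

(** * The unit ball and the class Q *)

Section Ball.
Variables (R : realType) (n : nat).
Local Notation C := (Cplx R).
Local Notation I := (multiindex n).
Implicit Types (z w u : 'rV[C]_n) (K M J : I) (j : 'I_n) (S : R).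

(** The terms of the given series are bounded at the point with coordinates
    [z + x], which is absolute convergence in the sense of [pconv]. *)
Lemma analytic_at_ball (F : 'rV[C]_n -> C) z :
  analytic_on_ball F -> unit_ball R n z -> analytic_at F z.
Proof.
move=> hF zB; have [a [rho [rho0 h]]] := hF z zB.
exists rho => //; exists a; split => [x xr|w zw]; last first.
  by apply/has_sum_of_cvg/h => j; have := zw j; rewrite !mxE.
pose w : 'rV[C]_n := z + map_mx (@ofreal R) x.
have xE : vabs (w - z) = x.
  apply/rowP => j; rewrite /w addrAC subrr add0r !mxE cabs_ofreal ger0_norm //.
  by case/andP: (xr j).
have [|b hb] := has_sum_bounded (has_sum_of_cvg (h w _)).
  move=> j; have := congr1 (fun v : 'rV[R]_n => v 0 j) xE; rewrite !mxE /= => ->.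
  by have /andP[_] := xr j; rewrite mxE.
by exists b => K; have := hb K; rewrite cabsM cabs_mpow xE.
Qed.

Lemma sum_sqr_le (p : 'I_n -> R) : (\sum_j p j) ^+ 2 <= n%:R * \sum_j p j ^+ 2.
Proof.
case: n p => [p|k p]; first by rewrite !big_ord0 expr0n mulr0.
set m := \sum_j p j; have h : 0 <= \sum_j (k.+1%:R * p j - m) ^+ 2.
  by apply: sumr_ge0 => j _; exact: sqr_ge0.
have : \sum_j (k.+1%:R * p j - m) ^+ 2 = k.+1%:R * (k.+1%:R * \sum_j p j ^+ 2 - m ^+ 2).
  transitivity (\sum_j (k.+1%:R ^+ 2 * p j ^+ 2 - 2 * k.+1%:R * m * p j + m ^+ 2)).
    by apply: eq_bigr => j _; ring.
  rewrite big_split /= sumrB -!mulr_sumr -/m sumr_const card_ord -mulr_natl; ring.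
by move=> e; move: h; rewrite e pmulr_rge0 ?ltr0n // subr_ge0.
Qed.

Definition invL (L : 'rV[C]_n -> 'rV[R]_n) z : 'rV[R]_n := \row_j (L z 0 j)^-1.

Lemma cenorm_ge0 z : 0 <= cenorm z.
Proof. exact: sqrtr_ge0. Qed.

(** The entries of [|w - z|] are less than [e = (1 - |z|) / beta], and by
    Cauchy-Schwarz [|w| <= |z| + sqrt n * e < 1]: this is where
    [beta > sqrt n] enters. *)
Lemma odisc_ball beta (L : 'rV[C]_n -> 'rV[R]_n) z w :
  Num.sqrt n%:R < beta -> admissible beta L ->
  unit_ball R n z -> odisc z (invL L z) w -> unit_ball R n w.
Proof.
move=> hb hL zB zw; set P := cenorm z.
have P0 : 0 <= P := cenorm_ge0 z.
have P1 : P < 1 := zB.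
have nu0 : 0 <= Num.sqrt n%:R :> R := sqrtr_ge0 _.
have b0 : 0 < beta := le_lt_trans nu0 hb.
pose e := (1 - P) / beta.
have e0 : 0 < e by rewrite divr_gt0 // subr_gt0.
have hw j : vabs w 0 j <= vabs z 0 j + e.
  have := vabsD_le 0 z w j; rewrite !subr0 => /le_trans; apply.
  rewrite lerD2l; apply: (le_trans (ltW (zw j))); rewrite mxE.
  have := (hL j).2 z zB; rewrite -/P => h.
  have d0 : 0 < beta / (1 - P) by rewrite divr_gt0 // subr_gt0.
  have l0 : 0 < L z 0 j by exact: lt_trans h.
  by rewrite /e -(invf_div beta) lef_pV2 //; exact: ltW.
have PE : \sum_j vabs z 0 j ^+ 2 = P ^+ 2.
  by rewrite sqr_sqrtr // sumr_ge0 // => j _; exact: sqr_ge0.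
have sumle : \sum_j vabs z 0 j <= Num.sqrt n%:R * P.
  rewrite -(@ler_pXn2r _ 2) ?nnegrE ?mulr_ge0 //; last first.
    by apply: sumr_ge0 => j _; exact: vabs_ge0.
  by rewrite exprMn sqr_sqrtr // -PE sum_sqr_le.
have hlt : Num.sqrt n%:R * e < 1 - P.
  by rewrite /e mulrCA gtr_pMr ?subr_gt0 // ltr_pdivrMr // mul1r.
rewrite /unit_ball /= /cenorm /enorm -[X in _ < X]sqrtr1 ltr_sqrt //.
apply: (@le_lt_trans _ _ ((P + Num.sqrt n%:R * e) ^+ 2)); last first.
  have ne0 := mulr_ge0 nu0 (ltW e0).
  by rewrite expr_lt1 ?addr_ge0 //; move: hlt; lra.
apply: (@le_trans _ _ (\sum_j (vabs z 0 j + e) ^+ 2)).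
  apply: ler_sum => j _; rewrite lerXn2r ?nnegrE //; first exact: vabs_ge0.
  by rewrite addr_ge0 ?vabs_ge0 // ltW.
have -> : \sum_j (vabs z 0 j + e) ^+ 2 =
    P ^+ 2 + 2 * e * (\sum_j vabs z 0 j) + n%:R * e ^+ 2.
  transitivity (\sum_j (vabs z 0 j ^+ 2 + 2 * e * vabs z 0 j + e ^+ 2)).
    by apply: eq_bigr => j _; ring.
  by rewrite !big_split /= PE -mulr_sumr sumr_const card_ord [n%:R * _]mulr_natl.
have -> : n%:R * e ^+ 2 = (Num.sqrt n%:R * e) ^+ 2 by rewrite [RHS]exprMn sqr_sqrtr.
rewrite sqrrD lerD2r lerD2l [leRHS](_ : _ = 2 * e * (Num.sqrt n%:R * P)); last by ring.
by rewrite ler_pM2l // mulr_gt0.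
Qed.

Lemma admissible_gt0 beta (L : 'rV[C]_n -> 'rV[R]_n) z j :
  0 < beta -> admissible beta L -> unit_ball R n z -> 0 < L z 0 j.
Proof.
move=> b0 hL zB; apply: lt_trans ((hL j).2 z zB).
by rewrite divr_gt0 // subr_gt0.
Qed.

(** The defining property of the class for [r = (1, ..., 1)], whose norm
    [sqrt n] is less than [beta]. *)
Lemma classQ_ratio beta (L : 'rV[C]_n -> 'rV[R]_n) :
  Num.sqrt n%:R < beta -> classQ beta L ->
  exists2 lam : R, 1 <= lam & forall z w j, unit_ball R n z ->
    odisc z (invL L z) w -> L w 0 j <= lam * L z 0 j /\ L z 0 j <= lam * L w 0 j.
Proof.
move=> hb [adm hQ].
have b0 : 0 < beta := le_lt_trans (sqrtr_ge0 _) hb.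
pose r : 'rV[R]_n := const_mx 1.
have r0 j : 0 <= r 0 j by rewrite mxE.
have rb : enorm r <= beta.
  rewrite /enorm (eq_bigr (fun=> 1)); last by move=> j _; rewrite mxE expr1n.
  by rewrite sumr_const card_ord ltW.
have l1 j : 0 < fine (lambda1 L j r) /\ (fine (lambda1 L j r))%:E = lambda1 L j r.
  have [h1 h12 h2] := hQ r r0 rb j.
  have f1 : lambda1 L j r \is a fin_num.
    by rewrite ge0_fin_numE ?(le_lt_trans h12) // ltW.
  by rewrite fine_gt0 ?h1 ?(le_lt_trans h12) // fineK.
have l2 j : 0 < fine (lambda2 L j r) /\ (fine (lambda2 L j r))%:E = lambda2 L j r.
  have [h1 h12 h2] := hQ r r0 rb j.
  have h0 : (0 < lambda2 L j r)%E by exact: lt_le_trans h12.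
  by rewrite fine_gt0 ?h0 ?h2 // fineK // ge0_fin_numE // ltW.
pose g j := fine (lambda2 L j r) + (fine (lambda1 L j r))^-1.
have g0 j : 0 <= g j by rewrite addr_ge0 ?invr_ge0 ?ltW ?(l1 j).1 ?(l2 j).1.
have gle j : g j <= \sum_j g j.
  by rewrite (bigD1 j) //= lerDl sumr_ge0.
exists (1 + \sum_j g j); first by rewrite lerDl sumr_ge0.
move=> z w j zB zw.
have wB := odisc_ball hb adm zB zw.
have Lz : 0 < L z 0 j := admissible_gt0 j b0 adm zB.
have Lw : 0 < L w 0 j := admissible_gt0 j b0 adm wB.
have hr : ratios L j r (L w 0 j / L z 0 j)%:E.
  exists z, w; split => // i; have := zw i.
  by rewrite !mxE div1r => /ltW.
have := ereal_sup_ubound hr; rewrite -/(lambda2 L j r) -(l2 j).2 lee_fin => up.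
have := ereal_inf_lbound hr; rewrite -/(lambda1 L j r) -(l1 j).2 lee_fin => lo.
have i1 := (l1 j).1; have i2 := (l2 j).1.
have gj := gle j.
split; rewrite -ler_pdivrMr //.
  apply: (le_trans up); apply: (le_trans _ (le_trans gj _)); last by rewrite lerDr.
  by rewrite lerDl invr_ge0 ltW.
rewrite -invf_div.
apply: (@le_trans _ _ (fine (lambda1 L j r))^-1).
  by rewrite lef_pV2 ?posrE // divr_gt0.
apply: (le_trans _ (le_trans gj _)); last by rewrite lerDr.
by rewrite lerDr ltW.
Qed.

End Ball.

Section Index.
Variables (R : realType) (n : nat) (beta : R).
Local Notation C := (Cplx R).
Local Notation I := (multiindex n).
Variables (L : 'rV[C]_n -> 'rV[R]_n) (F : 'rV[C]_n -> C).
Hypothesis hbeta : Num.sqrt n%:R < beta.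
Hypothesis hL : classQ beta L.
Hypothesis hF : analytic_on_ball F.
Implicit Types (z w u : 'rV[C]_n) (K M J : I) (j : 'I_n) (S : R).

Let beta0 : 0 < beta. Proof. exact: le_lt_trans (sqrtr_ge0 _) hbeta. Qed.

Lemma mpow_invL w K : mpow (invL L w) K = (mpow (L w) K)^-1.
Proof. by rewrite /mpow -prodfV; apply: eq_bigr => j _; rewrite mxE exprVn. Qed.

Lemma index_termE w K : index_term L F w K = wcoef F (invL L w) w K.
Proof.
rewrite /index_term /wcoef mpow_invL /tcoef cabsM cabsV cabs_nat.
by rewrite invfM mulrA.
Qed.

Lemma index_term_ge0 w K : unit_ball R n w -> 0 <= index_term L F w K.
Proof.
move=> wB; rewrite divr_ge0 ?cabs_ge0 // mulr_ge0 // mpow_ge0 // => j.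
by rewrite ltW // (admissible_gt0 j beta0 hL.1).
Qed.

(** Both sides of the theorem imply this for some [N] and [c], and
    [controlled_decay] leads back from it to either. *)
Definition controlled N c := forall z S, unit_ball R n z ->
  (forall K, (mdeg K <= N)%N -> index_term L F z K <= S) ->
  forall J, index_term L F z J <= c * S.

Lemma wcoef_change (lam : R) (r r' : 'rV[R]_n) w K :
  (forall j, 0 <= r 0 j) -> (forall j, r 0 j <= lam * r' 0 j) ->
  wcoef F r w K <= lam ^+ mdeg K * wcoef F r' w K.
Proof.
move=> r0 rr; rewrite /wcoef mulrCA ler_wpM2l ?cabs_ge0 // -mpow_scale.
by apply: ler_mpow => j; rewrite mxE r0 rr.
Qed.

(** [wcoef_decay] with the weights [r = 1 / L z]: the comparison of [L w] with
    [L z] costs a factor [lam ^ N] on the low-order terms and [lam ^ |J|] on the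
    others. *)
Theorem controlled_decay N c : 0 <= c -> controlled N c ->
  exists s D : R, [/\ 0 < s, 0 <= D & forall z S, unit_ball R n z ->
    (forall K, (mdeg K <= N)%N -> index_term L F z K <= S) ->
    forall J, index_term L F z J * (1 + s) ^+ mdeg J <= D * S].
Proof.
move=> c0 hc; have [lam lam1 hlam] := classQ_ratio hbeta hL.
have lam0 : 0 < lam := lt_le_trans ltr01 lam1.
pose c' := c * lam ^+ N.
have cc' : c <= c' by rewrite ler_peMr // exprn_ege1.
have c'0 : 0 <= c' := le_trans c0 cc'.
pose p := (Num.truncn (4 * lam)).+1.
have hp : 4 * lam <= p%:R by rewrite ltW // truncnS_gt.
exists (4 * lam)^-1, (c' * ((4 * lam) ^+ N * (c' * 2 ^+ n)) ^+ p * 2 ^+ n).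
split; first by rewrite invr_gt0 mulr_gt0.
  have l4 : 0 <= 4 * lam by rewrite mulr_ge0 // ltW.
  by apply: mulr_ge0 => //; apply: mulr_ge0 => //; apply: exprn_ge0;
    apply: mulr_ge0; [exact: exprn_ge0|exact: mulr_ge0].
move=> z S zB hS J; rewrite index_termE.
have invL_gt0 w j : unit_ball R n w -> 0 < invL L w 0 j.
  by move=> wB; rewrite mxE invr_gt0 (admissible_gt0 j beta0 hL.1).
have inB w : odisc z (invL L z) w -> unit_ball R n w.
  exact: odisc_ball hbeta hL.1 zB.
have invL_le w j : odisc z (invL L z) w ->
    invL L w 0 j <= lam * invL L z 0 j /\ invL L z 0 j <= lam * invL L w 0 j.
  move=> zw; have [h1 h2] := hlam z w j zB zw.
  have Lz := admissible_gt0 j beta0 hL.1 zB.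
  have Lw := admissible_gt0 j beta0 hL.1 (inB w zw).
  by split; rewrite !mxE ler_pdivlMr // mulrC ler_pdivrMr.
apply: (@wcoef_decay _ _ _ _ z N lam c') => //.
- by move=> j; exact: invL_gt0.
- move=> w u zw wu; apply: analytic_at_ball => //.
  apply: (odisc_ball hbeta hL.1 (inB w zw)) => j.
  apply: (lt_le_trans (wu j)); rewrite mxE mulrC ler_pdivrMr // mulrC.
  by have [] := invL_le w j zw.
- move=> w S' zw low J'.
  have wB := inB w zw.
  apply: (le_trans (@wcoef_change lam _ (invL L w) w J' _ _)).
  + by move=> j; rewrite ltW // invL_gt0.
  + by move=> j; have [] := invL_le w j zw.
  rewrite -index_termE [leRHS](_ : _ = lam ^+ mdeg J' * (c * (lam ^+ N * S'))); last first.
    by rewrite /c'; ring.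
  rewrite ler_wpM2l ?exprn_ge0 //; first exact: ltW. apply: (hc w _ wB) => K KN.
  rewrite index_termE.
  apply: (le_trans (@wcoef_change lam _ (invL L z) w K _ _)).
  + by move=> j; rewrite ltW // invL_gt0.
  + by move=> j; have [] := invL_le w j zw.
  have ge0 : 0 <= wcoef F (invL L z) w K.
    by rewrite mulr_ge0 ?cabs_ge0 // mpow_ge0 // => j; rewrite ltW // invL_gt0.
  apply: ler_pM => //; [by rewrite exprn_ge0 // ltW| |exact: low].
  by rewrite ler_weXn2l.
- move=> S' low J'; rewrite -index_termE.
  have low' K : (mdeg K <= N)%N -> index_term L F z K <= S'.
    by move=> KN; rewrite index_termE; exact: low.
  apply: (le_trans (hc z S' zB low' J')); rewrite ler_wpM2r //.
  have S'0 : index_term L F z midx0 <= S'.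
    by apply: low'; rewrite /mdeg big1 // => j _; rewrite ffunE.
  by apply: le_trans S'0; exact: index_term_ge0.
- by move=> K KN; rewrite -index_termE hS.
Qed.

End Index.

(** * Bounded index and dominated tails *)

Section Esum.
Variables (R : realType) (I : choiceType).
Implicit Types (f : I -> R) (P : set I).

Lemma esum_le_fin f P (b : R) :
  (forall A : {fset I}, (forall i, i \in A -> P i) -> \sum_(i <- A) f i <= b) ->
  (\esum_(i in P) (f i)%:E <= b%:E)%E.
Proof.
move=> h; apply: ge_ereal_sup => _ [A [finA AP] <-].
rewrite fsbig_finite //= sumEFin lee_fin; apply: h => i.
by rewrite in_fset_set // => /set_mem /AP.
Qed.

Lemma fin_le_esum f P (A : {fset I}) : (forall i, i \in A -> P i) ->
  ((\sum_(i <- A) f i)%:E <= \esum_(i in P) (f i)%:E)%E.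
Proof.
move=> AP; apply: esum_ge; exists [set` A]; first by split.
by rewrite fsbig_finite //= set_fsetK sumEFin.
Qed.

End Esum.

Lemma bernoulli_le (R : realDomainType) (s : R) m : 0 <= s -> 1 + m%:R * s <= (1 + s) ^+ m.
Proof.
move=> s0; elim: m => [|m IH]; first by rewrite mul0r addr0.
rewrite exprSr; apply: (le_trans _ (ler_wpM2r _ IH)); last exact: addr_ge0.
rewrite -natr1 (_ : (1 + m%:R * s) * (1 + s) = 1 + (m%:R + 1) * s + m%:R * s ^+ 2); last by ring.
by rewrite lerDl mulr_ge0 ?exprn_ge0.
Qed.

Section Main.
Variables (R : realType) (n : nat) (beta : R).
Local Notation C := (Cplx R).
Local Notation I := (multiindex n).
Variables (L : 'rV[C]_n -> 'rV[R]_n) (F : 'rV[C]_n -> C).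
Hypothesis hbeta : Num.sqrt n%:R < beta.
Hypothesis hL : classQ beta L.
Hypothesis hF : analytic_on_ball F.
Implicit Types (z w u : 'rV[C]_n) (K M J : I) (j : 'I_n) (S : R).

Let term_ge0 w K : unit_ball R n w -> 0 <= index_term L F w K.
Proof. exact: (@index_term_ge0 R n beta L F hbeta hL). Qed.

(** With the low-order sum [S], the decay bounds the tail by [D S] times a
    geometric series in each variable. *)
Lemma bounded_index_tail : bounded_index L F ->
  exists (c : R) (N : nat), [/\ 0 < c, (0 < N)%N &
    forall z, unit_ball R n z ->
      (c%:E * (\esum_(K in [set K : I | (N.+1 <= mdeg K)%N]) (index_term L F z K)%:E)
       <= \esum_(K in [set K : I | (mdeg K <= N)%N]) (index_term L F z K)%:E)%E].
Proof.
move=> [m hm].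
have ctl : controlled L F m 1.
  move=> z S zB hS J; rewrite mul1r; apply: (le_trans (hm z zB J)).
  apply/bigmax_leP; split => [|K Km]; last exact: hS.
  apply: (le_trans (term_ge0 midx0 zB)); apply: hS.
  by rewrite /mdeg big1 // => j _; rewrite ffunE.
have [s [D [s0 D0 hD]]] := controlled_decay hbeta hL hF ler01 ctl.
pose N := maxn m 1; pose q := (1 + s)^-1.
have s1 : 0 < 1 + s by rewrite addr_gt0.
have q01 : 0 <= q < 1 by rewrite invr_ge0 ltW //= invf_lt1 // ltrDl.
pose E := D * (1 - q)^-1 ^+ n.
have E0 : 0 <= E.
  by rewrite mulr_ge0 // exprn_ge0 // invr_ge0 subr_ge0; case/andP: q01 => _ /ltW.
have E1 : 0 < E + 1 by rewrite ltr_wpDl.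
exists (E + 1)^-1, N; split; first by rewrite invr_gt0.
  by rewrite /N leq_maxr.
move=> z zB; pose A : {fset I} := [fset K in mbox n N | (mdeg K <= N)%N].
pose S := \sum_(K <- A) index_term L F z K.
have hS K : (mdeg K <= m)%N -> index_term L F z K <= S.
  move=> Km; have KN : (mdeg K <= N)%N by rewrite (leq_trans Km) // leq_maxl.
  rewrite /S (big_fsetD1 K) /=; last first.
    by rewrite !inE /= KN andbT (fsubsetP (mbox_mono _ KN)) // mem_mbox.
  by rewrite lerDl sumr_ge0 // => i _; exact: term_ge0.
have S0 : 0 <= S by rewrite sumr_ge0 // => i _; exact: term_ge0.
apply: (@le_trans _ _ ((E + 1)^-1%:E * (E * S)%:E)%E).
  rewrite lee_wpmul2l ?lee_fin ?invr_ge0 ?(ltW E1) //.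
  apply: esum_le_fin => B _.
  apply: (@le_trans _ _ (\sum_(K <- B) D * S * q ^+ mdeg K)).
    apply: ler_sum => K _; rewrite /q exprVn ler_pdivlMr ?exprn_gt0 //.
    exact: hD.
  rewrite -mulr_sumr (_ : E * S = D * S * (1 - q)^-1 ^+ n); last by rewrite /E; ring.
  by rewrite ler_wpM2l ?mulr_ge0 //; exact: mgeometric.
apply: (@le_trans _ _ S%:E); last first.
  by apply: fin_le_esum => K; rewrite !inE /= => /andP[].
rewrite -EFinM lee_fin mulrC ler_pdivrMr // mulrC.
by rewrite ler_wpM2l // lerDl.
Qed.

(** The low-order sum has at most [k] terms, hence [F] is controlled; once
    [(1 + s) ^ m >= D], the decay absorbs the constant [D] for all indices of
    degree greater than [m]. *)
Lemma tail_bounded_index (c : R) (N : nat) : 0 < c ->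
  (forall z, unit_ball R n z ->
      (c%:E * (\esum_(K in [set K : I | (N.+1 <= mdeg K)%N]) (index_term L F z K)%:E)
       <= \esum_(K in [set K : I | (mdeg K <= N)%N]) (index_term L F z K)%:E)%E) ->
  bounded_index L F.
Proof.
move=> c0 hc; pose k : R := (#|` mbox n N|)%:R.
have k0 : 0 <= k by [].
have kc0 : 0 <= k / c by rewrite divr_ge0 // ltW.
have ctl : controlled L F N (1 + k / c).
  move=> z S zB hS J; have S0 : 0 <= S.
    apply: (le_trans (term_ge0 midx0 zB)); apply: hS.
    by rewrite /mdeg big1 // => j _; rewrite ffunE.
  have [JN|JN] := leqP (mdeg J) N.
    by apply: (le_trans (hS J JN)); rewrite ler_peMl // lerDl.
  have : (c%:E * (index_term L F z J)%:E <= (k * S)%:E)%E.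
    apply: (le_trans _ (le_trans (hc z zB) _)).
      rewrite lee_wpmul2l ?lee_fin ?(ltW c0) //.
      have := @fin_le_esum _ _ (index_term L F z) [set K : I | (N.+1 <= mdeg K)%N] [fset J].
      by rewrite big_seq_fset1; apply => K; rewrite inE => /eqP ->.
    apply: esum_le_fin => A AN.
    have AB : A `<=` mbox n N.
      by apply/fsubsetP => K /AN KN; rewrite (fsubsetP (mbox_mono _ KN)) // mem_mbox.
    apply: (@le_trans _ _ (\sum_(K <- A) S)).
      by rewrite big_seq [leRHS]big_seq; apply: ler_sum => K /AN /hS.
    apply: (le_trans (ler_sum_fset _ AB)) => [_|]; first exact: S0.
    by rewrite big_const_seq count_predT iter_addr addr0 -mulr_natl.
  rewrite -EFinM lee_fin mulrC -ler_pdivlMr // => /le_trans; apply.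
  by rewrite mulrDl mul1r mulrAC ler_wpDl.
have [s [D [s0 D0 hD]]] := controlled_decay hbeta hL hF (addr_ge0 ler01 kc0) ctl.
pose m := maxn N (Num.truncn (D / s)).+1; exists m => z zB J.
have Dm : D <= (1 + s) ^+ m.
  apply: (le_trans _ (bernoulli_le m (ltW s0))).
  apply: (@le_trans _ _ (m%:R * s)); last by rewrite lerDr.
  rewrite -ler_pdivrMr //; apply: (le_trans (ltW (truncnS_gt _))).
  by rewrite ler_nat leq_maxr.
set S := \big[_/_]_(_ | _) _.
have low K : (mdeg K <= m)%N -> index_term L F z K <= S.
  move=> Km; have /imfsetP[K' _ KE] := fsubsetP (mbox_mono n Km) _ (mem_mbox K).
  rewrite KE in Km *; rewrite /S.
  exact: (@le_bigmax_cond _ _ {ffun 'I_n -> 'I_m.+1} 0 K'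
    (fun H => (mdeg (mwiden H) <= m)%N) (fun H => index_term L F z (mwiden H))).
have [Jm|Jm] := leqP (mdeg J) m; first exact: low.
have S0 : 0 <= S by exact: bigmax_ge_id.
have s1 : 1 <= 1 + s by rewrite lerDl ltW.
have low' K : (mdeg K <= N)%N -> index_term L F z K <= S.
  by move=> KN; apply: low; rewrite (leq_trans KN) // leq_maxl.
have := hD z S zB low' J.
have p0 : 0 < (1 + s) ^+ mdeg J by rewrite exprn_gt0 // (lt_le_trans ltr01).
rewrite -ler_pdivlMr // => /le_trans; apply.
rewrite ler_pdivrMr // mulrC ler_wpM2l //; apply: (le_trans Dm).
by rewrite ler_weXn2l // ltnW.
Qed.

End Main.

Theorem theorem10 (R : realType) (n : nat) (beta : R)
    (L : 'rV[Cplx R]_n -> 'rV[R]_n) (F : 'rV[Cplx R]_n -> Cplx R)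
    (hbeta : Num.sqrt n%:R < beta)
    (hL : classQ beta L)
    (hF : analytic_on_ball F) :
  bounded_index L F <->
  exists (c : R) (N : nat), [/\ 0 < c, (0 < N)%N &
    forall z : 'rV[Cplx R]_n, unit_ball R n z ->
      (\esum_(K in [set K : multiindex n | (mdeg K <= N)%N])
          (index_term L F z K)%:E >=
       c%:E * \esum_(K in [set K : multiindex n | (N.+1 <= mdeg K)%N])
          (index_term L F z K)%:E)%E].
Proof.
split; first exact: bounded_index_tail hbeta hL hF.
by move=> [c [N [c0 _ h]]]; exact: tail_bounded_index hbeta hL hF _ _ c0 h.
Qed.
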